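(* Let $\zeta\in K_\infty$ with $|\zeta|<1$, let $$X=\mathrm{Spec}\,K_\infty[a,b,c,d]/(a+d+2\zeta,\ ad-bc-\zeta^2),\qquad \Delta_1=\begin{pmatrix}a&b\\c&d\end{pmatrix},\qquad \Delta=\mathrm{Id}+t\Delta_1,$$ and let $\widetilde{\underline{\mathcal F}}$ be the rigid analytic $\tau$-sheaf over $A(1)=K_\infty\langle t\rangle$ on $X^{\mathrm{rig}}$ with underlying sheaf $\mathcal O^{\oplus2}$ and $\tau=\Delta\cdot\sigma$. Let $g\in\mathrm{GL}_2(\mathbb F_q)$ act on $X$ and $X^{\mathrm{rig}}$, and hence on $\mathcal M(X^{\mathrm{rig}})$, by $\Delta\mapsto g\Delta g^{-1}$. Then $$\{y\in\mathcal M(X^{\mathrm{rig}}): y^*\widetilde{\underline{\mathcal F}}\text{ is analytically trivial}\}=\bigcup_{g\in\mathrm{GL}_2(\mathbb F_q)}g\,\{y\in\mathcal M(X^{\mathrm{rig}}):|a(y)|,|c(y)|,|d(y)|<1\}.$$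
   Context: Here $A=\mathbb F_q[t]$ ($C=\mathbb P^1$), $K_\infty$ is the completion of $\mathrm{Frac}(A)$ at the place $\infty$ (so isomorphic to a Laurent series field $\mathbb F_q((1/\theta))$, where $\theta$ is the image of $t$; elements of $K_\infty$ are constants, distinct from the coefficient variable $t$), and the base field is $L=K_\infty$. $A(1)=L\langle t\rangle$ is the Tate algebra and $\mathfrak A(1)=\mathrm{Sp}\,L\langle t\rangle$. $X^{\mathrm{rig}}$ is the rigid analytification of $X$ and $\mathcal M(X^{\mathrm{rig}})$ is its set of analytic points: for an affinoid $\mathrm{Sp}\,B$, $\mathcal M(\mathrm{Sp}\,B)$ is the set of continuous multiplicative non-archimedean seminorms on $B$ extending the norm of $L$, and $\mathcal M(X^{\mathrm{rig}})$ is glued from those of an admissible affinoid covering. For $y\in\mathcal M(X^{\mathrm{rig}})$, $k(y)$ is its complete residue field and $a(y),\dots,d(y)\in k(y)$ are the values of the coordinate functions; $\Delta(y)=\mathrm{Id}+t\begin{pmatrix}a(y)&b(y)\\c(y)&d(y)\end{pmatrix}$. $\sigma$ acts on power series in $t$ by raising all coefficients to the $q$-th power: $\sigma(\sum b_nt^n)=\sum b_n^qt^n$. $\tau=\Delta\cdot\sigma$ is the $\sigma$-semilinear operator $f\mapsto\Delta\,{}^\sigma\!f$ on column vectors. $y^*\widetilde{\underline{\mathcal F}}$ denotes the pullback of $\widetilde{\underline{\mathcal F}}$ to $\mathrm{Sp}\,k(y)$. It is analytically trivial if, for $F$ the completion of an algebraic closure of $k(y)$, the $\mathbb F_q[t]$-module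 $\{f\in F\langle t\rangle^2:\Delta(y)\,{}^\sigma\!f=f\}$ has rank $2$, the rank of the sheaf. *)

(* Defs.v *)
From HB Require Import structures.
From mathcomp Require Import all_boot all_order all_algebra.
From mathcomp Require Import boolp classical_sets reals mpoly.

Set Implicit Arguments.
Unset Strict Implicit.
Unset Printing Implicit Defensive.

Import Order.TTheory GRing.Theory Num.Theory.
Local Open Scope ring_scope.
Local Open Scope classical_set_scope.

HB.mixin Record hasNonarchAbs (R : realType) K of GRing.Field K := {
  abs : K -> R;
  abs_ge0 : forall x, 0 <= abs x;
  abs_eq0 : forall x, (abs x == 0) = (x == 0);
  absM : forall x y, abs (x * y) = abs x * abs y;
  abs_ultra : forall x y, abs (x + y) <= Num.max (abs x) (abs y)
}.

#[short(type="nonarchFieldType")]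
HB.structure Definition NonarchField (R : realType) :=
  {K of hasNonarchAbs R K & GRing.Field K}.

Definition abs_cauchy (R : realType) (K : nonarchFieldType R) (u : nat -> K) :=
  forall e : R, 0 < e -> exists N, forall m n,
    (N <= m)%N -> (N <= n)%N -> abs (u m - u n) < e.

Definition abs_converges (R : realType) (K : nonarchFieldType R)
    (u : nat -> K) (l : K) :=
  forall e : R, 0 < e -> exists N, forall n, (N <= n)%N -> abs (u n - l) < e.

HB.mixin Record isAbsComplete (R : realType) K of NonarchField R K := {
  abs_complete : forall u : nat -> K, abs_cauchy u -> exists l, abs_converges u l
}.

#[short(type="completeNonarchFieldType")]
HB.structure Definition CompleteNonarchField (R : realType) :=
  {K of isAbsComplete R K & NonarchField R K}.

Section AbsTheory.
Context {R : realType} {K : nonarchFieldType R}.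
Implicit Types x y : K.

Lemma abs0 : abs (0 : K) = 0.
Proof. by apply/eqP; rewrite abs_eq0. Qed.

Lemma abs1 : abs (1 : K) = 1.
Proof.
have n0 : abs (1 : K) != 0 by rewrite abs_eq0 oner_eq0.
by apply: (mulfI n0); rewrite -absM !mulr1.
Qed.

Lemma absX x n : abs (x ^+ n) = abs x ^+ n.
Proof. by elim: n => [|n ih]; rewrite ?expr0 ?abs1 // !exprS absM ih. Qed.

Lemma absN x : abs (- x) = abs x.
Proof.
rewrite -mulN1r absM.
suff -> : abs (-1 : K) = 1 by rewrite mul1r.
apply/eqP; rewrite -(@pexpr_eq1 _ _ 2) ?abs_ge0 //.
by rewrite -absX sqrrN expr1n abs1.
Qed.

Lemma abs_sum_le (I : Type) (r : seq I) (P : pred I) (f : I -> K) (B : R) :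
  0 <= B -> (forall i, P i -> abs (f i) <= B) ->
  abs (\sum_(i <- r | P i) f i) <= B.
Proof.
move=> B0 h; elim/big_ind: _ => // [|x y hx hy]; first by rewrite abs0.
by apply: le_trans (abs_ultra _ _) _; rewrite ge_max hx.
Qed.

Lemma abs_sum_lt (I : Type) (r : seq I) (P : pred I) (f : I -> K) (B : R) :
  0 < B -> (forall i, P i -> abs (f i) < B) ->
  abs (\sum_(i <- r | P i) f i) < B.
Proof.
move=> B0 h; elim/big_ind: _ => // [|x y hx hy]; first by rewrite abs0.
by apply: le_lt_trans (abs_ultra _ _) _; rewrite gt_max hx.
Qed.

End AbsTheory.

(* The completion of F_q(t) for the absolute value |f/g| = c^(deg f - deg g),
   characterised as a complete field in which F_q(t) is dense.  The constant
   c > 1 is a choice of normalisation (c = |theta|). *)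
Record infinity_completion (R : realType) (Fq : finFieldType) :=
  InfinityCompletion {
  Kinf :> completeNonarchFieldType R;
  Kinf_of : {rmorphism {fraction {poly Fq}} -> Kinf};
  Kinf_base : R;
  Kinf_base_gt1 : 1 < Kinf_base;
  Kinf_abs : forall p : {poly Fq}, p != 0 ->
    abs (Kinf_of (FracField.tofrac p)) = Kinf_base ^+ (size p).-1;
  Kinf_dense : forall (x : Kinf) (e : R), 0 < e ->
    exists s, abs (x - Kinf_of s) < e
}.

Section Kinf.
Context {R : realType} {Fq : finFieldType} (L : infinity_completion R Fq).

Definition theta : L := Kinf_of L (FracField.tofrac 'X).

Definition Kinf_const (c : Fq) : L := Kinf_of L (FracField.tofrac c%:P).

Lemma Kinf_const_is_zmod : zmod_morphism Kinf_const.
Proof. by move=> x y; rewrite /Kinf_const !rmorphB. Qed.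

Lemma Kinf_const_is_monoid : monoid_morphism Kinf_const.
Proof. by split=> [|x y]; rewrite /Kinf_const ?rmorph1 ?rmorphM. Qed.

HB.instance Definition _ :=
  GRing.isZmodMorphism.Build Fq L Kinf_const Kinf_const_is_zmod.
HB.instance Definition _ :=
  GRing.isMonoidMorphism.Build Fq L Kinf_const Kinf_const_is_monoid.

Lemma abs_Kinf_const c : abs (Kinf_const c) <= 1.
Proof.
have [->|c0] := eqVneq c 0; first by rewrite rmorph0 abs0.
by rewrite Kinf_abs ?polyC_eq0 // size_polyC c0.
Qed.

Lemma abs_theta : abs theta = Kinf_base L.
Proof. by rewrite Kinf_abs ?polyX_eq0 // size_polyX. Qed.

End Kinf.

Record mps (n : nat) (A : Type) := MPS { mps_coef : 'X_{1..n} -> A }.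

HB.instance Definition _ n A := gen_eqMixin (mps n A).
HB.instance Definition _ n A := gen_choiceMixin (mps n A).

Lemma mpsP n A (f g : mps n A) : mps_coef f =1 mps_coef g -> f = g.
Proof. by case: f g => [f] [g] /= /funext ->. Qed.

Section PowerSeries.
Context {n : nat} {A : comNzRingType}.
Implicit Types (f g h : mps n A) (p q : {mpoly A[n]}) (m : 'X_{1..n}).

Definition mps_of_mpoly p : mps n A := MPS (fun m => p@_m).

Definition mps_add f g : mps n A := MPS (fun m => mps_coef f m + mps_coef g m).
Definition mps_opp f : mps n A := MPS (fun m => - mps_coef f m).
Definition mps_mul f g : mps n A := MPS (fun m =>
  \sum_(k : 'X_{1..n < (mdeg m).+1, (mdeg m).+1} | m == (k.1 + k.2)%MM)
    mps_coef f k.1 * mps_coef g k.2).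

Definition mps_trunc d f : {mpoly A[n]} :=
  \sum_(k : 'X_{1..n < d}) mps_coef f k *: 'X_[k].

Definition agree d p f := forall m, (mdeg m < d)%N -> p@_m = mps_coef f m.

Lemma agree_trunc d f : agree d (mps_trunc d f) f.
Proof. by move=> m hm; rewrite mcoeff_mpoly. Qed.

Lemma agree_of_mpoly d p : agree d p (mps_of_mpoly p).
Proof. by []. Qed.

Lemma agree_eq d p f g : agree d p f -> agree d p g ->
  forall m, (mdeg m < d)%N -> mps_coef f m = mps_coef g m.
Proof. by move=> h1 h2 m hm; rewrite -h1 // h2. Qed.

Lemma agree_mul d p q f g :
  agree d p f -> agree d q g -> agree d (p * q) (mps_mul f g).
Proof.
move=> hp hq m hm; rewrite mcoeffM; apply: eq_bigr => k _.
by rewrite hp ?hq // (leq_trans (bmdeg _) hm).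
Qed.

Lemma mps_eq f g :
  (forall d, exists p, agree d p f /\ agree d p g) -> f = g.
Proof.
move=> h; apply: mpsP => m.
by have [p [h1 h2]] := h (mdeg m).+1; apply: (agree_eq h1 h2).
Qed.

Lemma mps_addA : associative mps_add.
Proof. by move=> f g h; apply: mpsP => m /=; rewrite addrA. Qed.
Lemma mps_addC : commutative mps_add.
Proof. by move=> f g; apply: mpsP => m /=; rewrite addrC. Qed.
Lemma mps_add0 : left_id (mps_of_mpoly 0) mps_add.
Proof. by move=> f; apply: mpsP => m /=; rewrite mcoeff0 add0r. Qed.
Lemma mps_addN : left_inverse (mps_of_mpoly 0) mps_opp mps_add.
Proof. by move=> f; apply: mpsP => m /=; rewrite mcoeff0 addNr. Qed.

HB.instance Definition _ := GRing.isZmodule.Build (mps n A)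
  mps_addA mps_addC mps_add0 mps_addN.

Lemma mps_mulA : associative mps_mul.
Proof.
move=> f g h; apply: mps_eq => d.
exists (mps_trunc d f * (mps_trunc d g * mps_trunc d h)); split;
  [|rewrite mulrA]; by do !apply: agree_mul; apply: agree_trunc.
Qed.

Lemma mps_mulC : commutative mps_mul.
Proof.
move=> f g; apply: mps_eq => d; exists (mps_trunc d f * mps_trunc d g).
by split; [|rewrite mulrC]; apply: agree_mul; apply: agree_trunc.
Qed.

Lemma mps_mul1 : left_id (mps_of_mpoly 1) mps_mul.
Proof.
move=> f; apply: mps_eq => d; exists (1 * mps_trunc d f); split.
  by apply: agree_mul => //; apply: agree_trunc.
by rewrite mul1r; apply: agree_trunc.
Qed.

Lemma mps_mulDl : left_distributive mps_mul mps_add.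
Proof.
move=> f g h; apply: mpsP => m /=; rewrite -big_split.
by apply: eq_bigr => k _ /=; rewrite mulrDl.
Qed.

Lemma mps_one_neq0 : mps_of_mpoly 1 != 0.
Proof.
apply/eqP => /(congr1 (fun f => mps_coef f 0%MM)) /eqP /=.
by rewrite mcoeff0 mcoeff1 eqxx oner_eq0.
Qed.

HB.instance Definition _ := GRing.Zmodule_isComNzRing.Build (mps n A)
  mps_mulA mps_mulC mps_mul1 mps_mulDl mps_one_neq0.

Lemma mps_of_mpoly_is_zmod : zmod_morphism mps_of_mpoly.
Proof. by move=> p q; apply: mpsP => m /=; rewrite mcoeffB. Qed.

Lemma mps_of_mpoly_is_monoid : monoid_morphism mps_of_mpoly.
Proof.
split=> // p q; apply: mps_eq => d; exists (p * q); split=> //.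
exact: agree_mul.
Qed.

HB.instance Definition _ := GRing.isZmodMorphism.Build {mpoly A[n]} (mps n A)
  mps_of_mpoly mps_of_mpoly_is_zmod.
HB.instance Definition _ := GRing.isMonoidMorphism.Build {mpoly A[n]} (mps n A)
  mps_of_mpoly mps_of_mpoly_is_monoid.

Lemma mps_coef0 m : mps_coef (0 : mps n A) m = 0.
Proof. exact: mcoeff0. Qed.
Lemma mps_coef1 m : mps_coef (1 : mps n A) m = (m == 0%MM)%:R.
Proof. exact: mcoeff1. Qed.
Lemma mps_coefB f g m : mps_coef (f - g) m = mps_coef f m - mps_coef g m.
Proof. by []. Qed.

(* Substitution of linear forms for the variables: a linear substitution
   respects the grading, so the m-th coefficient only involves the terms of
   degree mdeg m and no convergence is needed. *)
Definition mps_linsubst (lq : n.-tuple {mpoly A[n]}) f : mps n A :=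
  MPS (fun m => (mps_trunc (mdeg m).+1 f \mPo lq)@_m).

Context (lq : n.-tuple {mpoly A[n]}).
Hypothesis lq_homog : forall i, tnth lq i \is 1.-homog.

Definition lqmon m : {mpoly A[n]} := \prod_(i < n) tnth lq i ^+ m i.

Lemma lqmon_homog m : lqmon m \is (mdeg m).-homog.
Proof.
rewrite mdegE /lqmon; elim/big_rec2: _ => [|i d p _ h]; first exact: dhomog1.
by apply: dhomogM => //; rewrite -[X in X.-homog]mul1n; apply: dhomogMn.
Qed.

Lemma comp_low d p : (forall m, (mdeg m < d)%N -> p@_m = 0) ->
  forall m, (mdeg m < d)%N -> (p \mPo lq)@_m = 0.
Proof.
move=> h m hm; rewrite comp_mpolyEX raddf_sum big1 //= => k _.
rewrite comp_mpolyX -/(lqmon k) mcoeffZ.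
have [hk|hk] := ltnP (mdeg k) d; first by rewrite h // mul0r.
rewrite (dhomog_nemf_coeff (lqmon_homog k)) ?mulr0 //.
by apply: contraTneq hm => ->; rewrite -leqNgt.
Qed.

Lemma comp_agree d p q : (forall m, (mdeg m < d)%N -> p@_m = q@_m) ->
  forall m, (mdeg m < d)%N -> (p \mPo lq)@_m = (q \mPo lq)@_m.
Proof.
move=> h m hm; apply/eqP; rewrite -subr_eq0 -mcoeffB -comp_mpolyB.
apply/eqP/(@comp_low d) => // k hk; by rewrite mcoeffB h // subrr.
Qed.

Lemma agree_linsubst d p f :
  agree d p f -> agree d (p \mPo lq) (mps_linsubst lq f).
Proof.
move=> h m hm /=; apply: (@comp_agree (mdeg m).+1) => // k hk.
by rewrite h ?agree_trunc // (leq_trans hk).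
Qed.

Lemma mps_linsubst_mpoly p :
  mps_linsubst lq (mps_of_mpoly p) = mps_of_mpoly (p \mPo lq).
Proof.
apply: mps_eq => d; exists (p \mPo lq); split => //.
exact: agree_linsubst.
Qed.

Lemma mps_linsubst_is_zmod : zmod_morphism (mps_linsubst lq).
Proof.
move=> f g; apply: mps_eq => d.
exists ((mps_trunc d f - mps_trunc d g) \mPo lq); split.
  by apply: agree_linsubst => m hm; rewrite mcoeffB !agree_trunc.
move=> m hm; rewrite comp_mpolyB mcoeffB.
by rewrite !(agree_linsubst (@agree_trunc d _)).
Qed.

Lemma mps_linsubst_is_monoid : monoid_morphism (mps_linsubst lq).
Proof.
split=> [|f g].
  by rewrite -[1]/(mps_of_mpoly 1) mps_linsubst_mpoly comp_mpoly1.
apply: mps_eq => d; exists ((mps_trunc d f * mps_trunc d g) \mPo lq); split.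
  by apply/agree_linsubst/agree_mul; apply: agree_trunc.
by rewrite rmorphM; apply: agree_mul; apply/agree_linsubst/agree_trunc.
Qed.

Lemma mps_linsubstE f m : mps_coef (mps_linsubst lq f) m =
  \sum_(k : 'X_{1..n < (mdeg m).+1} | mdeg k == mdeg m)
     mps_coef f k * (lqmon k)@_m.
Proof.
rewrite /= /mps_trunc (raddf_sum (comp_mpoly lq)) raddf_sum /= (bigID (fun k => mdeg (bmnm k) == mdeg m)) /=.
rewrite [X in _ + X]big1 => [|k hk].
  by rewrite addr0; apply: eq_bigr => k _; rewrite comp_mpolyZ comp_mpolyX mcoeffZ.
rewrite comp_mpolyZ comp_mpolyX mcoeffZ.
by rewrite (dhomog_nemf_coeff (lqmon_homog k)) ?mulr0 // eq_sym.
Qed.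

End PowerSeries.

(* tate K n s is K<x_1/s,...,x_n/s>: the power series sum_m f_m x^m with
   f_m s^|m| -> 0, i.e. those converging on the closed polydisc of radius |s|.
   For s = 1 and n = 1 it is K<t>. *)
Definition tate_pred (R : realType) (K : nonarchFieldType R) (n : nat) (s : K)
    (f : mps n K) : Prop :=
  forall e : R, 0 < e -> exists N, forall m : 'X_{1..n}, (N <= mdeg m)%N ->
    abs (mps_coef f m * s ^+ mdeg m) < e.

Definition tate_bool (R : realType) (K : nonarchFieldType R) (n : nat) (s : K) :
  {pred mps n K} := fun f => `[< tate_pred s f >].

Record tate (R : realType) (K : nonarchFieldType R) (n : nat) (s : K) := Tate {
  tate_val : mps n K;
  tateP : tate_val \in @tate_bool R K n s
}.

Section Tate.
Context {R : realType} {K : nonarchFieldType R} {n : nat} {s : K}.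
Implicit Types (f g : mps n K) (p q : {mpoly K[n]}) (m : 'X_{1..n}).

Local Notation wt f m := (abs (mps_coef f m * s ^+ mdeg m)).

Lemma tate_bounded f : tate_pred s f -> exists2 B, 0 < B & forall m, wt f m <= B.
Proof.
move=> /(_ 1 ltr01) [N hN].
exists (1 + \sum_(k : 'X_{1..n < N}) wt f k).
  by rewrite ltr_pwDl // sumr_ge0 // => i _; apply: abs_ge0.
move=> m; have [hm|hm] := leqP N (mdeg m).
  apply: le_trans (ltW (hN m hm)) _; rewrite lerDl sumr_ge0 // => i _.
  exact: abs_ge0.
rewrite (bigD1 (BMultinom hm)) //= addrCA lerDl addr_ge0 //.
by rewrite sumr_ge0 // => i _; apply: abs_ge0.
Qed.

Lemma tate_mpoly p : tate_pred s (mps_of_mpoly p).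
Proof.
move=> e e0; exists (msize p) => m hm /=.
by rewrite memN_msupp_eq0 ?mul0r ?abs0 //; apply: contraTN hm => /msize_mdeg_lt;
  rewrite -ltnNge.
Qed.

Lemma tate_sub f g : tate_pred s f -> tate_pred s g -> tate_pred s (f - g).
Proof.
move=> hf hg e e0; have [N1 h1] := hf e e0; have [N2 h2] := hg e e0.
exists (maxn N1 N2) => m; rewrite geq_max => /andP[/h1 a1 /h2 a2].
rewrite mps_coefB mulrBl; apply: le_lt_trans (abs_ultra _ _) _.
by rewrite absN gt_max a1 a2.
Qed.

Lemma tate_mul f g : tate_pred s f -> tate_pred s g -> tate_pred s (f * g).
Proof.
move=> hf hg e e0.
have [Bf Bf0 hBf] := tate_bounded hf; have [Bg Bg0 hBg] := tate_bounded hg.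
have [N1 h1] := hf (e / Bg) (divr_gt0 e0 Bg0).
have [N2 h2] := hg (e / Bf) (divr_gt0 e0 Bf0).
exists (N1 + N2)%N => m hm; rewrite /= mulr_suml.
apply: abs_sum_lt => // k /eqP mE.
have dE : mdeg m = (mdeg k.1 + mdeg k.2)%N by rewrite -mdegD -mE.
have -> : mps_coef f k.1 * mps_coef g k.2 * s ^+ mdeg m =
    (mps_coef f k.1 * s ^+ mdeg k.1) * (mps_coef g k.2 * s ^+ mdeg k.2).
  by rewrite mulrACA -exprD -dE.
rewrite absM.
have [k1|k1] := leqP N1 (mdeg k.1).
  rewrite -[e](@divfK _ Bg) ?gt_eqF //.
  apply: (@le_lt_trans _ _ (wt f k.1 * Bg)).
    by apply: ler_wpM2l (hBg _); apply: abs_ge0.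
  by rewrite ltr_pM2r // h1.
have k2 : (N2 <= mdeg k.2)%N.
  rewrite leqNgt; apply/negP => k2.
  by have := leq_trans (leq_add k1 (ltnW k2)) hm; rewrite addSn -dE ltnn.
rewrite -[e](@divfK _ Bf) ?gt_eqF // mulrC.
apply: (@le_lt_trans _ _ (wt g k.2 * Bf)).
  by apply: ler_wpM2l (hBf _); apply: abs_ge0.
by rewrite ltr_pM2r // h2.
Qed.

Lemma tate_subring : subring_closed (@tate_bool R K n s).
Proof.
split=> [|f g|f g]; rewrite ?[_ \in _]asboolE.
- by apply/asboolP; exact: tate_mpoly 1.
- by move=> /asboolP hf /asboolP hg; apply/asboolP/tate_sub.
- by move=> /asboolP hf /asboolP hg; apply/asboolP/tate_mul.
Qed.

HB.instance Definition _ := GRing.isSubringClosed.Build (mps n K)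
  (@tate_bool R K n s) tate_subring.
HB.instance Definition _ := [isSub for @tate_val R K n s].
HB.instance Definition _ := [Choice of tate n s by <:].
HB.instance Definition _ := [SubChoice_isSubComNzRing of tate n s by <:].

Definition tate_of_mpoly p : tate n s :=
  Tate (introT (asboolP _) (tate_mpoly p)).

Lemma tate_of_mpoly_is_zmod : zmod_morphism tate_of_mpoly.
Proof. by move=> p q; apply: val_inj; rewrite /= rmorphB. Qed.

Lemma tate_of_mpoly_is_monoid : monoid_morphism tate_of_mpoly.
Proof.
by split=> [|p q]; apply: val_inj; rewrite /= ?rmorph1 // rmorphM.
Qed.

HB.instance Definition _ := GRing.isZmodMorphism.Build {mpoly K[n]} (tate n s)
  tate_of_mpoly tate_of_mpoly_is_zmod.
HB.instance Definition _ := GRing.isMonoidMorphism.Build {mpoly K[n]} (tate n s)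
  tate_of_mpoly tate_of_mpoly_is_monoid.

Definition tate_const (c : K) : tate n s := tate_of_mpoly c%:MP.

Definition gauss_norm (f : tate n s) : R :=
  sup (range (fun m => abs (mps_coef (tate_val f) m * s ^+ mdeg m))).

Lemma tate_holds (f : tate n s) : tate_pred s (tate_val f).
Proof. by apply/asboolP; exact: (tateP f). Qed.

Lemma gauss_norm_ub (f : tate n s) m : wt (tate_val f) m <= gauss_norm f.
Proof.
have [B _ hB] := tate_bounded (@tate_holds f).
by apply: ub_le_sup; [exists B => _ [k _ <-]; apply: hB|exists m].
Qed.

Lemma gauss_norm_le (f : tate n s) B : (forall m, wt (tate_val f) m <= B) ->
  gauss_norm f <= B.
Proof.
move=> h; apply: ge_sup; first by exists (wt (tate_val f) (0%MM : 'X_{1..n})), 0%MM.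
by move=> _ [k _ <-]; apply: h.
Qed.

Context (lq : n.-tuple {mpoly K[n]}).
Hypothesis lq_homog : forall i, tnth lq i \is 1.-homog.
Hypothesis lq_int : forall i m, abs (tnth lq i)@_m <= 1.

Lemma lqmon_int k m : abs (lqmon lq k)@_m <= 1.
Proof.
pose P (p : {mpoly K[n]}) := forall m, abs p@_m <= 1.
have P1 : P 1.
  by move=> m'; rewrite mcoeff1; case: eqP => _; rewrite ?abs0 ?abs1.
have PM p q : P p -> P q -> P (p * q).
  move=> hp hq m'; rewrite mcoeffM; apply: abs_sum_le => // i _.
  by rewrite absM mulr_ile1 ?abs_ge0.
suff : P (lqmon lq k) by apply.
apply: big_ind => // i _; elim: (k i) => [|d ih]; rewrite ?expr0 // exprS.
by apply: PM => // m'; apply: lq_int.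
Qed.

Lemma linsubst_le f (B : R) m : 0 <= B ->
  (forall k : 'X_{1..n}, mdeg k = mdeg m -> wt f k <= B) ->
  wt (mps_linsubst lq f) m <= B.
Proof.
move=> B0 h; rewrite mps_linsubstE // mulr_suml.
apply: abs_sum_le => // k /eqP mE.
have := h k mE; rewrite mE => hk; rewrite mulrAC absM; apply: le_trans hk.
by rewrite ler_piMr ?abs_ge0 // lqmon_int.
Qed.

Lemma tate_linsubst_pred f : tate_pred s f -> tate_pred s (mps_linsubst lq f).
Proof.
move=> hf e e0; have [N hN] := hf (e / 2) (divr_gt0 e0 (ltr0Sn _ 1)).
exists N => m hm; apply: (@le_lt_trans _ _ (e / 2)).
  by apply: linsubst_le => [|k kE]; rewrite ?ltW ?divr_gt0 ?hN ?kE.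
by rewrite ltr_pdivrMr // ltr_pMr // ltr1n.
Qed.

Definition tate_linsubst (f : tate n s) : tate n s :=
  Tate (introT (asboolP _) (tate_linsubst_pred (@tate_holds f))).

Lemma tate_linsubstB (f g : tate n s) :
  tate_linsubst (f - g) = tate_linsubst f - tate_linsubst g.
Proof. by apply: val_inj; apply: mps_linsubst_is_zmod. Qed.

Lemma tate_linsubstD (f g : tate n s) :
  tate_linsubst (f + g) = tate_linsubst f + tate_linsubst g.
Proof.
have h0 : tate_linsubst 0 = 0 by rewrite -{1}[0]subr0 tate_linsubstB subrr.
by rewrite -{1}[g]opprK -{1}[- g]sub0r !tate_linsubstB h0 sub0r opprK.
Qed.

Lemma tate_linsubstM (f g : tate n s) :
  tate_linsubst (f * g) = tate_linsubst f * tate_linsubst g.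
Proof.
by apply: val_inj; have [_] := mps_linsubst_is_monoid lq_homog; apply.
Qed.

Lemma tate_linsubst_mpoly p :
  tate_linsubst (tate_of_mpoly p) = tate_of_mpoly (p \mPo lq).
Proof. by apply: val_inj; apply: mps_linsubst_mpoly. Qed.

Lemma gauss_norm_linsubst (f : tate n s) : gauss_norm (tate_linsubst f) <= gauss_norm f.
Proof.
apply: gauss_norm_le => m; apply: linsubst_le => [|k _].
  by apply: le_trans (gauss_norm_ub f 0%MM); apply: abs_ge0.
exact: gauss_norm_ub.
Qed.

End Tate.

Section Restriction.
Context {R : realType} {K : nonarchFieldType R} {n : nat} {s s' : K}.

Lemma tate_restr_pred (le_s : abs s <= abs s') (f : mps n K) :
  tate_pred s' f -> tate_pred s f.
Proof.
move=> hf e /hf[N hN]; exists N => m /hN; apply: le_lt_trans.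
by rewrite !absM !absX ler_wpM2l ?abs_ge0 // lerXn2r ?nnegrE ?abs_ge0.
Qed.

(* Restriction of functions to a smaller polydisc. *)
Definition tate_restr (le_s : abs s <= abs s') (f : tate n s') : tate n s :=
  Tate (introT (asboolP _) (tate_restr_pred le_s (@tate_holds _ _ _ _ f))).

End Restriction.

Definition generic_mx (A : comNzRingType) : 'M[{mpoly A[2 * 2]}]_2 :=
  \matrix_(i, j) 'X_(mxvec_index i j).

Lemma det_mx2E (A : comNzRingType) (M : 'M[A]_2) :
  \det M = M 0 0 * M 1 1 - M 0 1 * M 1 0.
Proof.
have l0 : lift (0 : 'I_2) (0 : 'I_1) = 1 by apply/val_inj.
have l1 : lift (1 : 'I_2) (0 : 'I_1) = 0 by apply/val_inj.
rewrite (expand_det_row M 0) 2!big_ord_recl big_ord0 addr0 /cofactor !det_mx11.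
by rewrite !mxE ?l0 ?l1 /= expr0 expr1 mul1r mulN1r mulrN.
Qed.
Lemma mxtrace2E (A : comNzRingType) (M : 'M[A]_2) : \tr M = M 0 0 + M 1 1.
Proof.
have l0 : lift (0 : 'I_2) (0 : 'I_1) = 1 by apply/val_inj.
by rewrite /mxtrace 2!big_ord_recl big_ord0 addr0 l0.
Qed.

Section AnalyticPoints.
Context {R : realType} {Fq : finFieldType} (L : infinity_completion R Fq).
Variable zeta : L.

Local Notation a := (generic_mx L 0 0).
Local Notation b := (generic_mx L 0 1).
Local Notation c := (generic_mx L 1 0).
Local Notation d := (generic_mx L 1 1).

Definition trace_rel : {mpoly L[2 * 2]} := a + d + (2%:R * zeta)%:MP.
Definition det_rel : {mpoly L[2 * 2]} := a * d - b * c - (zeta ^+ 2)%:MP.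

(* X^rig is the increasing union of the affinoids X_N = Sp T_N / J_N cut out
   in X by |a|,|b|,|c|,|d| <= |theta|^N. *)
Definition ball_algebra (N : nat) := @tate R L (2 * 2) (theta L ^+ N).

Definition X_ideal (N : nat) : set (ball_algebra N) :=
  [set f | exists u v : ball_algebra N,
     f = u * tate_of_mpoly trace_rel + v * tate_of_mpoly det_rel].

(* M(X_N).  A seminorm on T_N / J_N is a seminorm on T_N vanishing on J_N, and
   it is continuous for the quotient topology iff it is so on T_N. *)
Record analytic_point (N : nat) := AnalyticPoint {
  snorm : ball_algebra N -> R;
  snorm_ge0 : forall f, 0 <= snorm f;
  snorm_ultra : forall f g, snorm (f + g) <= Num.max (snorm f) (snorm g);
  snormM : forall f g, snorm (f * g) = snorm f * snorm g;
  snorm_const : forall x : L, snorm (tate_const x) = abs x;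
  snorm_continuous : forall f (e : R), 0 < e -> exists2 r : R, 0 < r &
    forall g, gauss_norm (g - f) < r -> `|snorm g - snorm f| < e;
  snorm_ideal : forall f, X_ideal f -> snorm f = 0
}.

Lemma le_abs_thetaX N M : (N <= M)%N ->
  abs (theta L ^+ N) <= abs (theta L ^+ M).
Proof.
by move=> le_NM; rewrite !absX abs_theta ler_weXn2l // ltW // Kinf_base_gt1.
Qed.

(* M(X^rig) is glued from the M(X_N) along the inclusions X_N -> X_M, N <= M:
   two points are identified when their images in some M(X_M) coincide. *)
Definition local_point := {N : nat & analytic_point N}.

HB.instance Definition _ := gen_eqMixin local_point.
HB.instance Definition _ := gen_choiceMixin local_point.

Definition glued (P Q : local_point) : Prop :=
  exists M (leP : (tag P <= M)%N) (leQ : (tag Q <= M)%N),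
    forall f : ball_algebra M,
      snorm (tagged P) (tate_restr (le_abs_thetaX leP) f) =
      snorm (tagged Q) (tate_restr (le_abs_thetaX leQ) f).

Lemma glued_refl P : glued P P.
Proof. by exists (tag P), (leqnn _), (leqnn _). Qed.

Lemma glued_sym P Q : glued P Q -> glued Q P.
Proof. by case=> M [lP [lQ h]]; exists M, lQ, lP => f; rewrite h. Qed.

Lemma glued_trans P Q S : glued P Q -> glued Q S -> glued P S.
Proof.
case=> M [lP [lQ h]] [M' [lQ' [lS h']]].
have l1 := leq_maxl M M'; have l2 := leq_maxr M M'.
exists (maxn M M'), (leq_trans lP l1), (leq_trans lS l2) => f.
have e1 : tate_restr (le_abs_thetaX (leq_trans lP l1)) f =
    tate_restr (le_abs_thetaX lP) (tate_restr (le_abs_thetaX l1) f).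
  exact: val_inj.
have e2 : tate_restr (le_abs_thetaX lQ') (tate_restr (le_abs_thetaX l2) f) =
    tate_restr (le_abs_thetaX lQ) (tate_restr (le_abs_thetaX l1) f).
  exact: val_inj.
have e3 : tate_restr (le_abs_thetaX (leq_trans lS l2)) f =
    tate_restr (le_abs_thetaX lS) (tate_restr (le_abs_thetaX l2) f).
  exact: val_inj.
by rewrite e1 e3 h -h' e2.
Qed.

Definition gluedb : rel local_point := fun P Q => `[< glued P Q >].

Lemma gluedb_refl : reflexive gluedb.
Proof. by move=> P; apply/asboolP/glued_refl. Qed.
Lemma gluedb_sym P Q : gluedb P Q = gluedb Q P.
Proof. by apply/asboolP/asboolP; apply: glued_sym. Qed.
Lemma gluedb_trans : transitive gluedb.
Proof.
by move=> Q P S /asboolP h /asboolP h'; apply/asboolP/(glued_trans h h').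
Qed.

Canonical gluedb_equiv :=
  EquivRel gluedb gluedb_refl gluedb_sym gluedb_trans.

Definition Xan := {eq_quot gluedb_equiv}%qT.

Definition GL_mx (g : {'GL_2[Fq]}) : 'M[{mpoly L[2 * 2]}]_2 :=
  map_mx (fun x : Fq => (Kinf_const L x)%:MP) (GLval g).

Definition conj_generic_mx (g : {'GL_2[Fq]}) : 'M[{mpoly L[2 * 2]}]_2 :=
  GL_mx g *m generic_mx L *m GL_mx g^-1%g.

Definition conj_forms (g : {'GL_2[Fq]}) : (2 * 2).-tuple {mpoly L[2 * 2]} :=
  [tuple mxvec (conj_generic_mx g) 0 k | k < 2 * 2].

Lemma conj_formsE g i j :
  tnth (conj_forms g) (mxvec_index i j) = conj_generic_mx g i j.
Proof. by rewrite tnth_mktuple mxvecE. Qed.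

Lemma conj_forms_homog g k : tnth (conj_forms g) k \is 1.-homog.
Proof.
case/mxvec_indexP: k => i j; rewrite conj_formsE mxE.
apply: rpred_sum => l _; rewrite !mxE mulrC mul_mpolyC; apply: rpredZ.
apply: rpred_sum => l' _; rewrite !mxE mul_mpolyC; apply: rpredZ.
by rewrite dhomogX /= mdeg1.
Qed.

Lemma conj_forms_int g k m : abs (tnth (conj_forms g) k)@_m <= 1.
Proof.
case/mxvec_indexP: k => i j; rewrite conj_formsE mxE raddf_sum /=.
apply: abs_sum_le => // l _; rewrite !mxE mulrC mul_mpolyC mcoeffZ absM.
rewrite mulr_ile1 ?abs_ge0 ?abs_Kinf_const // raddf_sum /=.
apply: abs_sum_le => // l' _; rewrite !mxE mul_mpolyC mcoeffZ absM.
rewrite mulr_ile1 ?abs_ge0 ?abs_Kinf_const // mcoeffX.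
by case: eqP => _; rewrite ?abs0 ?abs1.
Qed.

(* f(Delta_1) |-> f(g Delta_1 g^-1); the entries of g have absolute value <= 1,
   so g preserves every X_N. *)
Definition conj_pullback (g : {'GL_2[Fq]}) (N : nat) :
  ball_algebra N -> ball_algebra N :=
  tate_linsubst (@conj_forms_homog g) (@conj_forms_int g).

Lemma comp_generic_mx g i j :
  generic_mx L i j \mPo conj_forms g = conj_generic_mx g i j.
Proof. by rewrite mxE comp_mpolyXU -tnth_nth conj_formsE. Qed.

Lemma GL_mxV g : GL_mx g^-1%g *m GL_mx g = 1%:M.
Proof.
pose h : {rmorphism Fq -> {mpoly L[2 * 2]}} :=
  (@mpolyC (2 * 2) L) \o Kinf_const L.
rewrite -[LHS]/(map_mx h (GLval g^-1%g) *m map_mx h (GLval g)) -map_mxM.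
by rewrite -[_ *m _]/(GLval (g^-1 * g)%g) mulVg /= map_mx1.
Qed.

Lemma comp_trace_rel g : trace_rel \mPo conj_forms g = trace_rel.
Proof.
rewrite /trace_rel !comp_mpolyD comp_mpolyC !comp_generic_mx; congr (_ + _).
by rewrite -!mxtrace2E mxtrace_mulC mulmxA GL_mxV mul1mx.
Qed.

Lemma comp_det_rel g : det_rel \mPo conj_forms g = det_rel.
Proof.
rewrite /det_rel !comp_mpolyB comp_mpolyC !(rmorphM (comp_mpoly _)) /= !comp_generic_mx.
congr (_ - _).
rewrite -!det_mx2E !det_mulmx mulrAC -[_ * \det (GL_mx _)]mulrC -det_mulmx GL_mxV.
by rewrite det1 mul1r.
Qed.

Lemma conj_pullback_ideal g N (f : ball_algebra N) :
  X_ideal f -> X_ideal (conj_pullback g f).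
Proof.
case=> u [v ->]; exists (conj_pullback g u), (conj_pullback g v).
rewrite /conj_pullback tate_linsubstD !tate_linsubstM.
by rewrite !tate_linsubst_mpoly comp_trace_rel comp_det_rel.
Qed.

Lemma conj_pullback_const g N (x : L) :
  conj_pullback g (tate_const x) = tate_const x :> ball_algebra N.
Proof. by rewrite /conj_pullback tate_linsubst_mpoly comp_mpolyC. Qed.

Section ConjPoint.
Variables (g : {'GL_2[Fq]}) (N : nat) (y : analytic_point N).

Let sn (f : ball_algebra N) : R := snorm y (conj_pullback g f).

Fact conj_point_ge0 f : 0 <= sn f.
Proof. exact: snorm_ge0. Qed.

Fact conj_point_ultra f h : sn (f + h) <= Num.max (sn f) (sn h).
Proof.
by rewrite /sn /conj_pullback tate_linsubstD; apply: snorm_ultra.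
Qed.

Fact conj_pointM f h : sn (f * h) = sn f * sn h.
Proof. by rewrite /sn /conj_pullback tate_linsubstM snormM. Qed.

Fact conj_point_const (x : L) : sn (tate_const x) = abs x.
Proof. by rewrite /sn conj_pullback_const snorm_const. Qed.

Fact conj_point_continuous f (e : R) : 0 < e -> exists2 r : R, 0 < r &
  forall h, gauss_norm (h - f) < r -> `|sn h - sn f| < e.
Proof.
move=> /(@snorm_continuous _ y (conj_pullback g f))[r r0 hr].
exists r => // h hh; apply: hr; apply: le_lt_trans hh.
by rewrite /conj_pullback -tate_linsubstB; apply: gauss_norm_linsubst.
Qed.

Fact conj_point_ideal f : X_ideal f -> sn f = 0.
Proof. by move=> hf; apply/snorm_ideal/conj_pullback_ideal. Qed.

Definition conj_point : analytic_point N :=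
  AnalyticPoint conj_point_ge0 conj_point_ultra conj_pointM conj_point_const
    conj_point_continuous conj_point_ideal.

End ConjPoint.

(* The point g y, at which Delta_1 takes the value g Delta_1(y) g^-1. *)
Definition conj_act (g : {'GL_2[Fq]}) (y : Xan) : Xan :=
  let P := repr y in \pi_Xan%qT (Tagged analytic_point (conj_point g (tagged P))).

End AnalyticPoints.

(* The complete residue field of y in M(X_N): the completion of the fraction
   field of T_N / ker y for the absolute value induced by y. *)
Record local_residue_field (R : realType) (Fq : finFieldType)
    (L : infinity_completion R Fq) (zeta : L) (N : nat)
    (y : analytic_point zeta N) := LocalResidueField {
  resf :> completeNonarchFieldType R;
  resf_eval : {rmorphism ball_algebra L N -> resf};
  resf_abs : forall f, abs (resf_eval f) = snorm y f;
  resf_dense : forall (x : resf) (e : R), 0 < e -> exists f h,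
    resf_eval h != 0 /\ abs (x - resf_eval f / resf_eval h) < e
}.

(* k(y); it does not depend on the chosen representative of y. *)
Definition residue_field (R : realType) (Fq : finFieldType)
    (L : infinity_completion R Fq) (zeta : L) (y : Xan zeta) :=
  local_residue_field (tagged (repr y)).

Record completed_alg_closure (R : realType) (k : nonarchFieldType R) :=
  CompletedAlgClosure {
  algc : nonarchFieldType R;
  algc_in : {rmorphism k -> algc};
  algc_abs : forall x, abs (algc_in x) = abs x;
  algc_algebraic : forall x : algc, algebraicOver algc_in x;
  algc_closed : GRing.closed_field_axiom algc;
  calgc :> completeNonarchFieldType R;
  calgc_in : {rmorphism algc -> calgc};
  calgc_abs : forall x, abs (calgc_in x) = abs x;
  calgc_dense : forall (x : calgc) (e : R), 0 < e ->
    exists s, abs (x - calgc_in s) < e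
}.

Section Tau.
Context {R : realType} (Fq : finFieldType) (F : nonarchFieldType R).

Definition tate1 := @tate R F 1 1.
Definition tate_t : tate1 := tate_of_mpoly 'X_ord0.

Lemma tate_sigma_pred (f : tate1) : tate_pred 1
  (MPS (fun m => mps_coef (tate_val f) m ^+ #|Fq|)).
Proof.
move=> e e0; have e1 : 0 < Num.min e 1 by rewrite lt_min e0 ltr01.
have [N hN] := tate_holds f e1; exists N => m /hN.
rewrite !expr1n !mulr1 lt_min => /andP[h1 h2] /=.
rewrite absX; apply: le_lt_trans h1; rewrite ler_iXnr ?abs_ge0 ?ltW //.
exact: ltnW (card_finNzRing_gt1 Fq).
Qed.

(* sum_n b_n t^n |-> sum_n b_n^q t^n. *)
Definition tate_sigma (f : tate1) : tate1 :=
  Tate (introT (asboolP _) (tate_sigma_pred f)).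

Definition tau (D : 'M[tate1]_2) (f : 'cV[tate1]_2) : 'cV[tate1]_2 :=
  D *m map_mx tate_sigma f.

(* The variable of F_q[t] acts as the variable t of F<t>, not as the constant
   theta. *)
Definition Fqt_scale (emb : Fq -> F) (p : {poly Fq}) (f : 'cV[tate1]_2) :
    'cV[tate1]_2 :=
  (map_poly (fun x => @tate_const R F 1 1 (emb x)) p).[tate_t] *: f.

End Tau.

(* Rank of a submodule S of an A-module V: the maximal number of A-linearly
   independent elements. *)
Definition lin_indep (A : nzRingType) (V : zmodType) (scale : A -> V -> V) (n : nat)
    (u : 'I_n -> V) :=
  forall x : 'I_n -> A, \sum_i scale (x i) (u i) = 0 -> forall i, x i = 0.

Definition has_rank (A : nzRingType) (V : zmodType) (scale : A -> V -> V)
    (S : set V) (r : nat) :=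
  (exists u : 'I_r -> V, (forall i, S (u i)) /\ lin_indep scale u) /\
  ~ (exists u : 'I_r.+1 -> V, (forall i, S (u i)) /\ lin_indep scale u).

Section AnalyticTriviality.
Context {R : realType} {Fq : finFieldType} (L : infinity_completion R Fq).
Context {zeta : L} {y : Xan zeta}.

Definition Delta1_at (k : residue_field y) : 'M[k]_2 :=
  \matrix_(i, j) resf_eval k (tate_of_mpoly (generic_mx L i j)).

Context {k : residue_field y} (F : completed_alg_closure k).

Definition closure_of (x : k) : F := calgc_in F (algc_in F x).

Definition Fq_in_closure (x : Fq) : F :=
  closure_of (resf_eval k (tate_const (Kinf_const L x))).

Definition Delta_at : 'M[tate1 F]_2 :=
  1%:M + tate_t F *: map_mx (fun x => tate_const (closure_of x)) (Delta1_at k).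

Definition analytically_trivial : Prop :=
  has_rank (Fqt_scale Fq_in_closure) [set f | tau Fq Delta_at f = f] 2.

End AnalyticTriviality.

(* Main.v *)
Require Import Defs.
From HB Require Import structures.
From mathcomp Require Import fingroup pgroup abelian finfield.
From mathcomp Require Import all_boot all_order all_algebra.
From mathcomp Require Import boolp classical_sets reals mpoly.
From mathcomp Require Import ring lra zify.

Set Implicit Arguments.
Unset Strict Implicit.
Unset Printing Implicit Defensive.

Import Order.TTheory GRing.Theory Num.Theory.
Local Open Scope ring_scope.
Local Open Scope classical_set_scope.

(* Write M = Delta_1(y).  In terms of coefficients, a fixed vector of tau is a
   sequence f_n in F^2 tending to 0 with f_0 in F_q^2 and
   f_(n+1) - f_(n+1)^(q) = M f_n^(q).

   Any fixed vectors span a module of rank at most 2, by counting: of the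
   F_q[t]-combinations of three of them with coefficients of degree < n there
   are q^(3n), but each is determined by about n coefficients, each of which
   takes at most q^2 values.

   If |a|, |c|, |d| < 1, solving x - x^q = w with |x|^q <= |w|, and |x| <= |w|
   when |w| < 1, makes f_n tend to 0 for any f_0: in the weighted norm
   max(|x|^q / max(|b|, 1), |y|) the recursion contracts every two steps.

   Conversely M + zeta is nilpotent; up to swapping the coordinates it is
   b (1, e)^T (-e, 1) with |e| <= 1.  If |b| >= 1 and |b| |e - c| >= 1 for all c
   in F_q, then |b| |e^q - e| >= 1, and this forces |b (z_n^q - e x_n^q)| >= 1
   for every n as soon as f_0 = (x_0, z_0) <> 0, so f_n does not tend to 0.
   Hence if there is a nonzero fixed vector then either |M| < 1 or
   |b| |e - c| < 1 for some c in F_q, and then a conjugation by an elementary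
   matrix moves y into the region. *)

(** * Absolute values and the Frobenius map *)

Lemma expr_lt_ex (R : realType) (r e : R) :
  0 <= r < 1 -> 0 < e -> exists N, r ^+ N < e.
Proof.
move=> /andP[r0 r1] e0; have [->|rn0] := eqVneq r 0.
  by exists 1%N; rewrite expr1.
have rgt0 : 0 < r by rewrite lt_def rn0.
pose h := r^-1 - 1.
have h0 : 0 < h by rewrite subr_gt0 invf_gt1.
(* Bernoulli's inequality; by the archimedean property its left side eventually exceeds e^-1. *)
have bern n : 1 + n%:R * h <= r^-1 ^+ n.
  elim: n => [|n ih]; first by rewrite mul0r addr0 expr0.
  rewrite exprSr; apply: le_trans (ler_wpM2r _ ih); last by rewrite invr_ge0.
  have -> : r^-1 = 1 + h by rewrite /h addrC subrK.
  rewrite -natr1; have := ler0n R n; nra.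
exists (Num.bound (e^-1 / h)).
have := archi_boundP (divr_ge0 (ltW (_ : 0 < e^-1)) (ltW h0)).
rewrite invr_gt0 => /(_ e0); rewrite ltr_pdivrMr // => hN.
have {hN} : e^-1 < r^-1 ^+ Num.bound (e^-1 / h).
  apply: lt_le_trans hN _; apply: le_trans (bern _).
  by rewrite lerDr ler01.
by rewrite exprVn ltf_pV2 ?posrE ?exprn_gt0.
Qed.

Section AbsFacts.
Context {R : realType} {F : nonarchFieldType R}.
Implicit Types x y : F.

Lemma abs_gt0 x : (0 < abs x) = (x != 0).
Proof. by rewrite lt_def abs_eq0 abs_ge0 andbT. Qed.

Lemma abs_subr x y : abs (x - y) <= Num.max (abs x) (abs y).
Proof. by rewrite -(absN y) abs_ultra. Qed.

Lemma abs_addr_lt x y : abs x < abs y -> abs (x + y) = abs y.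
Proof.
move=> lt_xy; apply/eqP; rewrite eq_le; apply/andP; split.
  by apply: le_trans (abs_ultra _ _) _; rewrite ge_max lexx ltW.
have := abs_subr (x + y) x; rewrite addrAC subrr add0r le_max.
by rewrite [abs y <= abs x]leNgt lt_xy orbF.
Qed.

Lemma abs_subr_lt x y : abs x < abs y -> abs (x - y) = abs y.
Proof. by rewrite -(absN y) => /abs_addr_lt. Qed.

Lemma abs_addl_lt x y : abs y < abs x -> abs (x + y) = abs x.
Proof. by rewrite addrC => /abs_addr_lt. Qed.

Lemma abs_subl_lt x y : abs y < abs x -> abs (x - y) = abs x.
Proof. by rewrite -(absN y) => /abs_addl_lt. Qed.

Lemma abs_prod (I : Type) (r : seq I) (P : pred I) (f : I -> F) :
  abs (\prod_(i <- r | P i) f i) = \prod_(i <- r | P i) abs (f i).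
Proof. exact: (big_morph _ absM abs1). Qed.

End AbsFacts.

(* The embedding is an argument only so that frob can be a ring morphism. *)
Definition frob (Fq : finFieldType) (F : fieldType)
  of {rmorphism Fq -> F} := fun x : F => x ^+ #|Fq|.

Section Frobenius.
Context {Fq : finFieldType} {F : fieldType} (emb : {rmorphism Fq -> F}).
Local Notation frob := (frob emb).

Lemma frobE x : frob x = x ^+ #|Fq|. Proof. by []. Qed.

(** The additive group of F_q is elementary abelian, so q is a power of the characteristic; this is
    what makes x -> x^q additive on F. *)
Lemma pnat_card : [pchar F].-nat #|Fq|.
Proof.
have [p p_pr pcharFq] := finPcharP Fq.
have pF : p \in [pchar F] by apply: (rmorph_pchar emb).
rewrite (eq_pnat _ (pcharf_eq pF)).
have := abelem_pgroup (fin_ring_pchar_abelem pcharFq).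
by rewrite /pgroup cardsT.
Qed.

Lemma frob_is_zmod : zmod_morphism frob.
Proof.
move=> x y; rewrite !frobE -{2}[x](subrK y) [in RHS]exprDn_pchar ?addrK //.
exact: pnat_card.
Qed.

Lemma frob_is_monoid : monoid_morphism frob.
Proof. by split=> [|x y]; rewrite !frobE ?expr1n ?exprMn. Qed.

HB.instance Definition _ := GRing.isZmodMorphism.Build F F frob frob_is_zmod.
HB.instance Definition _ :=
  GRing.isMonoidMorphism.Build F F frob frob_is_monoid.

Lemma frob_emb c : frob (emb c) = emb c.
Proof. by rewrite frobE -rmorphXn expf_card. Qed.

Lemma frob_sub_prod x : frob x - x = \prod_(c : Fq) (x - emb c).
Proof.
have := congr1 (fun p => (map_poly emb p).[x]) (finField_genPoly Fq).
rewrite rmorphB /= map_polyXn map_polyX rmorph_prod horner_prod !hornerE => ->.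
by apply: eq_bigr => c _; rewrite rmorphB /= map_polyX map_polyC !hornerE.
Qed.

Lemma frob_fixed x : frob x = x -> exists c, x = emb c.
Proof.
move/eqP; rewrite -subr_eq0 frob_sub_prod => /prodf_eq0 [c _].
by rewrite subr_eq0 => /eqP ->; exists c.
Qed.

End Frobenius.

(** * The equation x - x^q = w *)

Section ArtinSchreier.
Context {R : realType} {Fq : finFieldType} {F : nonarchFieldType R}.
Variable emb : {rmorphism Fq -> F}.
Local Notation q := #|Fq|.
Local Notation frob := (frob emb).

Lemma q_gt1 : (1 < q)%N. Proof. exact: card_finNzRing_gt1. Qed.
Lemma q_gt0 : (0 < q)%N. Proof. exact: ltnW q_gt1. Qed.

Lemma abs_frob x : abs (frob x) = abs x ^+ q.
Proof. exact: absX. Qed.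

Lemma abs_emb c : c != 0 -> abs (emb c) = 1.
Proof.
move=> c0; have h : abs (emb c) ^+ q = abs (emb c) by rewrite -abs_frob frob_emb.
have n0 : abs (emb c) != 0 by rewrite abs_eq0 fmorph_eq0.
apply/eqP; rewrite -(@pexpr_eq1 _ _ q.-1) ?abs_ge0 -?subn1 ?subn_gt0 ?q_gt1 //.
by rewrite -(inj_eq (mulfI n0)) -exprS subn1 prednK ?q_gt0 // h mulr1.
Qed.

Lemma abs_emb_le1 c : abs (emb c) <= 1.
Proof.
by have [->|/abs_emb ->//] := eqVneq c 0; rewrite rmorph0 abs0.
Qed.

Lemma exprq_le1 (x : R) : 0 <= x -> x <= 1 -> x ^+ q <= x.
Proof. by move=> x0 x1; rewrite ler_iXnr // q_gt0. Qed.

Lemma abs_AS_lt1 x : abs x < 1 -> abs (x - frob x) = abs x.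
Proof.
have [->|x0 x1] := eqVneq x 0; first by rewrite rmorph0 subr0.
apply: abs_subl_lt; rewrite abs_frob ltr_iXnr ?q_gt1 ?abs_gt0 //.
Qed.

(** The case |x| < 1 is excluded by [abs_AS_lt1], for |x| = 1 the ultrametric inequality bounds the
    left side by 1, and for |x| > 1 the term x^q dominates. *)
Lemma abs_AS_ge1 x : 1 <= abs (x - frob x) -> abs (x - frob x) = abs x ^+ q.
Proof.
move=> h; have [x1|x1|x1] := ltgtP (abs x) 1.
- by move: h; rewrite abs_AS_lt1 // leNgt x1.
- by rewrite abs_subr_lt ?abs_frob // ltr_eXnr ?q_gt1.
- rewrite x1 expr1n; apply/eqP; rewrite eq_le h andbT.
  by apply: le_trans (abs_subr _ _) _; rewrite abs_frob x1 expr1n maxxx.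
Qed.

End ArtinSchreier.

Section ArtinSchreierComplete.
Context {R : realType} {Fq : finFieldType} {F : completeNonarchFieldType R}.
Variable emb : {rmorphism Fq -> F}.
Local Notation q := #|Fq|.
Local Notation frob := (frob emb).

(** The root is the limit of the iteration x -> w + x^q started at 0, which stays in the disc |x| <=
    |w| and contracts there. *)
Lemma AS_small_root w : abs w < 1 -> exists2 x, x - frob x = w & abs x <= abs w.
Proof.
move=> w1; pose u := fix u n := if n is n'.+1 then w + frob (u n') else 0.
have uw n : abs (u n) <= abs w.
  elim: n => [|n ih] /=; first by rewrite abs0 abs_ge0.
  apply: le_trans (abs_ultra _ _) _; rewrite ge_max lexx abs_frob /=.
  apply: (le_trans _ (ih)); apply: exprq_le1; rewrite ?abs_ge0 //.
  exact: le_trans ih (ltW w1).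
have du n : abs (u n.+1 - u n) <= abs w ^+ n.
  elim: n => [|n ih]; first by rewrite subr0 expr0 (le_trans (uw _)) // ltW.
  have -> : u n.+2 - u n.+1 = frob (u n.+1 - u n).
    by rewrite rmorphB /= addrAC opprD addNKr addrC.
  have duw : abs (u n.+1 - u n) <= abs w.
    by apply: le_trans (abs_subr _ _) _; rewrite ge_max !uw.
  (* One factor of the q-th power is at most |w|; the remaining q - 1 >= 1 factors are together at
     most the previous difference. *)
  rewrite abs_frob exprS -(prednK (q_gt0 (Fq := Fq))) exprS.
  apply: ler_pM; rewrite ?exprn_ge0 ?abs_ge0 //.
  have q1 : (0 < q.-1)%N by rewrite -subn1 subn_gt0 q_gt1.
  apply: le_trans ih; rewrite ler_iXnr ?abs_ge0 //.
  exact: le_trans duw (ltW w1).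
have dum m n : (n <= m)%N -> abs (u m - u n) <= abs w ^+ n.
  move=> /subnK <-; elim: (m - n)%N => [|k ih].
    by rewrite add0n subrr abs0 exprn_ge0 ?abs_ge0.
  rewrite -(subrK (u (k + n)%N) (u (k.+1 + n)%N)) -addrA.
  apply: le_trans (abs_ultra _ _) _; rewrite ge_max ih andbT.
  by apply: le_trans (du _) _; rewrite exprD ler_piMl ?exprn_ge0 ?abs_ge0 //
    exprn_ile1 ?abs_ge0 ?ltW.
have wb : 0 <= abs w < 1 by rewrite abs_ge0.
have [|x ux] := abs_complete u.
  move=> e e0; have [N hN] := expr_lt_ex wb e0; exists N => m n hm hn.
  rewrite -(subrK (u N) (u m)) -addrA; apply: le_lt_trans (abs_ultra _ _) _.
  rewrite gt_max (le_lt_trans (dum _ _ hm)) //= -opprB absN.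
  exact: le_lt_trans (dum _ _ hn) hN.
have xw : abs x <= abs w.
  rewrite leNgt; apply/negP => wx.
  have [N /(_ N (leqnn _))] := ux (abs x) (le_lt_trans (abs_ge0 _) wx).
  by rewrite abs_subr_lt ?ltxx // (le_lt_trans (uw _)).
(* A nonzero defect x - x^q - w would exceed |u N - x| and |u N.+1 - x| for some N, but [dE] bounds
   it by the larger of these. *)
exists x => //; apply/eqP; rewrite -subr_eq0 -abs_eq0 eq_le abs_ge0 andbT.
rewrite leNgt; apply/negP => e0; have [N hN] := ux _ e0.
suff : abs (x - frob x - w) < abs (x - frob x - w) by rewrite ltxx.
have dE : x - frob x - w = frob (u N - x) - (u N.+1 - x).
  by rewrite rmorphB /=; ring.
rewrite [X in abs X < _]dE.
apply: le_lt_trans (abs_subr _ _) _; rewrite gt_max hN ?leqnSn // andbT.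
apply: le_lt_trans (hN N (leqnn _)).
rewrite abs_frob; apply: exprq_le1; rewrite ?abs_ge0 //.
apply: le_trans (abs_subr _ _) _; rewrite ge_max.
by rewrite (le_trans (uw _) (ltW w1)) (le_trans xw (ltW w1)).
Qed.

End ArtinSchreierComplete.

(** Some w' in the algebraic closure is within distance < 1 of w. The equation for w' has a root
    there, [AS_small_root] solves it for the remainder, and the roots add up. *)
Lemma AS_root_completion (R : realType) (Fq : finFieldType)
    (k : nonarchFieldType R) (F : completed_alg_closure k)
    (emb : {rmorphism Fq -> F}) (w : F) : exists x, x - frob emb x = w.
Proof.
have [w' hw'] := calgc_dense w ltr01.
have [x2 x2E _] := AS_small_root emb hw'.
(* [P] encodes y^q = y - w' in the shape of [algc_closed]. *)
pose P i := if i == 0%N then - w' else if i == 1%N then 1 else 0.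
have [y yE] := @algc_closed _ _ F #|Fq| P (q_gt0 (Fq := Fq)).
have {}yE : y ^+ #|Fq| = y - w'.
  rewrite yE; case E : #|Fq| (q_gt1 (Fq := Fq)) => [|[|n]] // _.
  rewrite 2!big_ord_recl /= expr0 expr1 mulr1 mul1r addrA big1 ?addr0 1?addrC//.
  by move=> i _; rewrite /P /= mul0r.
exists (calgc_in F y + x2).
rewrite rmorphD /= opprD addrACA x2E frobE -rmorphXn /= yE rmorphB /=.
ring.
Qed.

(** For |w| >= 1 any root has the right size by [abs_AS_ge1]; for |w| < 1 the small root is
    chosen. *)
Lemma AS_root_fun (R : realType) (Fq : finFieldType)
    (F : completeNonarchFieldType R) (emb : {rmorphism Fq -> F}) :
  (forall w, exists x, x - frob emb x = w) ->
  exists rho : F -> F, forall w,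
    [/\ rho w - frob emb (rho w) = w, abs (rho w) ^+ #|Fq| <= abs w
      & abs w < 1 -> abs (rho w) <= abs w].
Proof.
move=> AS; suff /choice [rho h] : forall w, exists x : F,
    [/\ x - frob emb x = w, abs x ^+ #|Fq| <= abs w
      & abs w < 1 -> abs x <= abs w] by exists rho.
move=> w; have [w1|w1] := ltP (abs w) 1.
  have [x xE xw] := AS_small_root emb w1; exists x; split=> //.
  by apply: (le_trans _ (xw)); apply: exprq_le1; rewrite ?abs_ge0 // (le_trans xw) ?ltW.
have [x xE] := AS w; exists x; split => //.
by rewrite -xE abs_AS_ge1 // xE.
Qed.

Lemma ord2P (P : 'I_2 -> Prop) : P 0 -> P 1 -> forall i, P i.
Proof.
move=> P0 P1 [[|[|i]] //= hi].
- by rewrite (_ : Ordinal hi = 0) //; apply: val_inj.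
- by rewrite (_ : Ordinal hi = 1) //; apply: val_inj.
Qed.

Lemma mul_mx2E (A : pzRingType) n (M : 'M[A]_2) (N : 'M[A]_(2, n)) i j :
  (M *m N) i j = M i 0 * N 0 j + M i 1 * N 1 j.
Proof.
rewrite mxE 2!big_ord_recl big_ord0 addr0.
by rewrite (_ : lift ord0 ord0 = 1) //; apply: val_inj.
Qed.

(** * Solutions that tend to 0 when |a|, |c|, |d| < 1 *)

Section Solutions.
Context {R : realType} {Fq : finFieldType} {F : nonarchFieldType R}.
Variable emb : {rmorphism Fq -> F}.
Local Notation q := #|Fq|.
Local Notation frob := (frob emb).

(* The equation f = (1 + t M) sigma(f) for f = sum_n (u n) t^n. *)
Definition tau_fixed (M : 'M[F]_2) (u : nat -> 'cV[F]_2) :=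
  u 0%N = map_mx frob (u 0%N) /\
  forall n, u n.+1 = map_mx frob (u n.+1) + M *m map_mx frob (u n).

Definition null_seq (u : nat -> 'cV[F]_2) := forall e : R, 0 < e ->
  exists N, forall n, (N <= n)%N -> forall i, abs (u n i 0) < e.

Lemma tau_fixed_coef M u n i : tau_fixed M u ->
  u n.+1 i 0 - frob (u n.+1 i 0) =
    M i 0 * frob (u n 0 0) + M i 1 * frob (u n 1 0).
Proof.
move=> [_ hu]; rewrite {1}hu mxE mul_mx2E !mxE; ring.
Qed.

Lemma null_seq_rho (rho : F -> F) M (v : 'cV[F]_2)
    (u := fix u n := if n is n'.+1
                     then map_mx rho (M *m map_mx frob (u n')) else v) :
  (forall w, [/\ rho w - frob (rho w) = w, abs (rho w) ^+ q <= abs w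
               & abs w < 1 -> abs (rho w) <= abs w]) ->
  (forall i, abs (v i 0) <= 1) ->
  abs (M 0 0) < 1 -> abs (M 1 0) < 1 -> abs (M 1 1) < 1 ->
  abs (M 0 1 * M 1 0) < 1 -> null_seq u.
Proof.
move=> rhoP v1 a1 c1 d1 bc1.
pose B := Num.max (abs (M 0 1)) 1.
have B1 : 1 <= B by rewrite le_max lexx orbT.
have cB : abs (M 1 0) * B < 1.
  rewrite /B maxEge; case: ifP => _; last by rewrite mulr1.
  by rewrite mulrC -absM.
pose dl := Num.max (Num.max (abs (M 0 0)) (abs (M 1 1))) (abs (M 1 0) * B).
have dl1 : dl < 1 by rewrite !gt_max a1 d1 cB.
have dl0 : 0 <= dl by rewrite !le_max abs_ge0.
(* This e replaces the square root of [dl]: it is < 1, and e^2 >= [dl] by the inequality of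
   arithmetic and geometric means. *)
pose e := (1 + dl) / 2.
have e0 : 0 < e by rewrite /e; lra.
have e1 : e < 1 by rewrite /e; lra.
have dle : dl <= e ^+ 2.
  by rewrite /e expr2; have := sqr_ge0 (1 - dl); rewrite expr2; nra.
have ae : abs (M 0 0) <= e ^+ 2 by apply: le_trans dle; rewrite !le_max lexx.
have de : abs (M 1 1) <= e ^+ 2.
  by apply: le_trans dle; rewrite !le_max lexx orbT.
have ce : abs (M 1 0) * B <= e ^+ 2.
  by apply: le_trans dle; rewrite !le_max lexx orbT.
have eX n : 0 < e ^+ n by rewrite exprn_gt0.
have eX1 n : e ^+ n <= 1 by rewrite exprn_ile1 ?ltW.
(* The entry b gains nothing, being bounded only by [B], while c gains e^2; the factor e on the left
   shares this gain evenly between two consecutive steps. *)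
have key n : e * abs (u n 0 0) ^+ q <= B * e ^+ n /\ abs (u n 1 0) <= e ^+ n.
  elim: n => [|n [ihx ihy]].
    rewrite !expr0 mulr1 v1; split=> //; apply: le_trans B1.
    by rewrite mulr_ile1 ?exprn_ge0 ?exprn_ile1 ?abs_ge0 ?v1 ?ltW.
  rewrite /= ![map_mx rho _ _ _]mxE; set w0 := (M *m _) 0 0; set w1 := (M *m _) 1 0.
  have [_ rx _] := rhoP w0; have [_ _ ry] := rhoP w1.
  have yq : abs (u n 1 0) ^+ q <= e ^+ n.
    apply: le_trans (ihy); apply: exprq_le1; first exact: abs_ge0.
    exact: le_trans ihy _.
  have xq0 := exprn_ge0 q (abs_ge0 (u n 0 0)).
  have yq0 := exprn_ge0 q (abs_ge0 (u n 1 0)).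
  have hw0 : e * abs w0 <= B * e ^+ n.+1.
    rewrite /w0 mul_mx2E !mxE -ler_pdivlMl //.
    apply: le_trans (abs_ultra _ _) _; rewrite !absM !abs_frob ge_max.
    rewrite !ler_pdivlMl //; apply/andP; split.
      have h := ler_pM (abs_ge0 (M 0 0)) (mulr_ge0 (ltW e0) xq0) ae ihx.
      rewrite mulrCA; apply: le_trans h _.
      rewrite mulrCA ler_wpM2l // ?(le_trans ler01) // [e ^+ n.+1]exprS.
      by rewrite expr2 -mulrA ler_wpM2l ?(ltW e0) // ler_piMl ?(ltW e1) ?ltW.
    rewrite mulrCA [e ^+ n.+1]exprS; have MB : abs (M 0 1) <= B by rewrite le_max lexx.
    apply: (ler_pM (abs_ge0 _) (mulr_ge0 (ltW e0) yq0) MB).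
    by rewrite ler_wpM2l // ltW.
  have hw1 : abs w1 <= e ^+ n.+1.
    rewrite /w1 mul_mx2E !mxE; apply: le_trans (abs_ultra _ _) _.
    rewrite !absM !abs_frob ge_max; apply/andP; split.
      rewrite -(ler_pM2l e0) mulrCA.
      apply: le_trans (ler_wpM2l (abs_ge0 _) ihx) _; rewrite mulrA.
      apply: le_trans (ler_wpM2r (ltW (eX n)) ce) _.
      by rewrite -exprD -exprS.
    apply: le_trans (ler_pM (abs_ge0 _) yq0 de yq) _.
    by rewrite -exprD addSn exprS ler_piMl ?(ltW e1) ?ltW.
  have w1_lt1 : abs w1 < 1.
    by apply: le_lt_trans hw1 _; rewrite exprn_ilt1 ?ltW.
  have hy := le_trans (ry w1_lt1) hw1.
  split=> //.
  by apply: le_trans hw0; rewrite ler_wpM2l ?(ltW e0).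
have Bp : 0 < B by apply: lt_le_trans B1.
have eb : 0 <= e < 1 by rewrite e1 ltW.
move=> r r0; have [N1 hN1] := expr_lt_ex eb r0.
have [N2 hN2] := expr_lt_ex eb
  (divr_gt0 (mulr_gt0 e0 (exprn_gt0 q r0)) Bp).
exists (maxn N1 N2) => n; rewrite geq_max => /andP[n1 n2].
have eXn N : (N <= n)%N -> e ^+ n <= e ^+ N.
  by move=> h; rewrite ler_wiXn2l ?ltW.
have [hx hy] := key n; apply: ord2P.
  rewrite -(@ltr_pXn2r _ q) ?nnegrE ?abs_ge0 ?(ltW r0) ?q_gt0 //.
  rewrite -(ltr_pM2l e0); apply: le_lt_trans hx _.
  by rewrite mulrC -ltr_pdivlMr // (le_lt_trans (eXn _ n2)).
by apply: le_lt_trans hy _; rewrite (le_lt_trans (eXn _ n1)).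
Qed.

End Solutions.

Lemma exists_null_solution (R : realType) (Fq : finFieldType)
    (F : completeNonarchFieldType R) (emb : {rmorphism Fq -> F})
    (M : 'M[F]_2) (v : 'cV[Fq]_2) :
  (forall w, exists x, x - frob emb x = w) ->
  abs (M 0 0) < 1 -> abs (M 1 0) < 1 -> abs (M 1 1) < 1 ->
  abs (M 0 1 * M 1 0) < 1 ->
  exists u, [/\ tau_fixed emb M u, null_seq u & u 0%N = map_mx emb v].
Proof.
move=> /AS_root_fun [rho rhoP] a1 c1 d1 bc1.
exists (fix u n := if n is n'.+1 then map_mx rho (M *m map_mx (frob emb) (u n'))
                   else map_mx emb v); split => //; last first.
  by apply: (null_seq_rho rhoP) => // i; rewrite mxE abs_emb_le1.
split=> [|n]; apply/matrixP => i j; first by rewrite !mxE frob_emb.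
rewrite /= [RHS]mxE ![map_mx _ _ i j]mxE.
by set w := (M *m _) i j; have [h _ _] := rhoP w; rewrite -{3}h addrC subrK.
Qed.

(** * A lower bound that keeps solutions away from 0 *)

Section NoNullSolution.
Context {R : realType} {Fq : finFieldType} {F : nonarchFieldType R}.
Variable emb : {rmorphism Fq -> F}.
Local Notation q := #|Fq|.
Local Notation frob := (frob emb).
Variables (zeta b e : F) (x z : nat -> F).
Hypotheses (zeta_lt1 : abs zeta < 1) (e_le1 : abs e <= 1).
Hypothesis b_ge1 : 1 <= abs b.
Hypothesis mu_ge1 : 1 <= abs (b * (frob e - e)).
Hypothesis xE : forall n, x n.+1 - frob (x n.+1) =
  (- zeta - b * e) * frob (x n) + b * frob (z n).
Hypothesis zE : forall n, z n.+1 - frob (z n.+1) =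
  (- (b * e ^+ 2)) * frob (x n) + (- zeta + b * e) * frob (z n).
(** The recursion is that of M = - zeta + b (1, e)^T (-e, 1), and [s n] is the multiple of (1, e)^T
    produced by M + zeta from (x_n^q, z_n^q)^T. *)
Let s n := b * (frob (z n) - e * frob (x n)).
Hypotheses (x0_le1 : abs (x 0) <= 1) (z0_le1 : abs (z 0) <= 1).
Hypothesis s0_ge1 : 1 <= abs (s 0).

Let L := abs b.
Let m := abs (b * (frob e - e)).

(* The middle bound keeps |s n|^q / L^(q-1) from exceeding m |s n| in the
   identity muE below, which is what makes |s n| nondecreasing. *)
Let invariant n := [/\ 1 <= abs (s n), abs (s n) ^+ q.-1 <= L ^+ q.-1 * m
                     & abs zeta * abs (x n) ^+ q < abs (s n)].

Let exprqS (t : R) : t ^+ q = t * t ^+ q.-1.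
Proof. by rewrite -exprS prednK ?q_gt0. Qed.

(** With dl = z_(n+1) - e x_(n+1), the relations |x_(n+1)|^q = |s n|, b dl = s n.+1 - zeta s n and
    |b dl^q| = |b dl|^q / L^(q-1) turn [muE] into a comparison of |s n.+1| with |s n|. *)
Lemma forms_ge1 n : 1 <= abs (s n).
Proof.
suff : invariant n by case.
have L0 : 0 < L by apply: lt_le_trans b_ge1.
have LX0 : 0 < L ^+ q.-1 by rewrite exprn_gt0.
elim: n => [|n [S1 SL zS]].
  split=> //.
    have sL : abs (s 0) <= L.
      rewrite absM ler_piMr ?abs_ge0 //; apply: le_trans (abs_subr _ _) _.
      by rewrite absM ge_max !abs_frob mulr_ile1 ?exprn_ge0 ?exprn_ile1 ?abs_ge0.
    apply: le_trans (_ : L ^+ q.-1 <= _); last by rewrite ler_peMr // (ltW LX0).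
    by apply: lerXn2r; rewrite ?nnegrE ?abs_ge0.
  apply: lt_le_trans s0_ge1; apply: le_lt_trans zeta_lt1.
  by rewrite ler_piMr ?abs_ge0 // exprn_ile1 ?abs_ge0.
set S := abs (s n) in S1 SL zS.
have S0 : 0 < S by apply: lt_le_trans S1.
have xS : abs (x n.+1) ^+ q = S.
  have xs : abs (x n.+1 - frob (x n.+1)) = S.
    rewrite xE (_ : _ * _ + _ = - (zeta * frob (x n)) + s n); last first.
      by rewrite /s; ring.
    by rewrite abs_addr_lt // absN absM abs_frob.
  by rewrite -(abs_AS_ge1 (emb := emb)) xs.
pose dl := z n.+1 - e * x n.+1.
have bdl : b * dl = s n.+1 - zeta * s n.
  rewrite /dl -[z _](subrK (frob (z n.+1))) -[x n.+1 in LHS](subrK (frob (x n.+1))).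
  by rewrite zE xE /s; ring.
have muE : b * (frob e - e) * frob (x n.+1) = s n.+1 - b * frob dl.
  by rewrite /s /dl rmorphB rmorphM /=; ring.
pose P := abs (b * frob dl).
have PL : P * L ^+ q.-1 = abs (b * dl) ^+ q.
  by rewrite /P !absM abs_frob exprMn (exprqS (abs b)) mulrAC.
have mS : m * S = abs (s n.+1 - b * frob dl).
  by rewrite -muE absM abs_frob xS.
have zsS : abs (zeta * s n) < S.
  by rewrite absM -[ltRHS]mul1r ltr_pM2r.
(* Otherwise |b dl| < S, and the bound on S^(q-1) gives |b dl^q| < m S; both terms on the right of
   [muE] are then smaller than its left side, of size m S. *)
have SS' : S <= abs (s n.+1).
  rewrite leNgt; apply/negP => lt_S.
  have D : abs (b * dl) < S.
    by rewrite bdl; apply: le_lt_trans (abs_subr _ _) _; rewrite gt_max lt_S.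
  have PS : P < m * S.
    rewrite -(ltr_pM2r LX0) PL.
    apply: lt_le_trans (_ : S ^+ q <= _).
      by rewrite ltr_pXn2r ?q_gt0 ?nnegrE ?abs_ge0.
    by rewrite exprqS [m * S]mulrC -mulrA [m * _]mulrC ler_pM2l.
  have := abs_subr (s n.+1) (b * frob dl); rewrite -mS leNgt gt_max PS andbT.
  by rewrite (lt_le_trans lt_S) // ler_peMl // (ltW S0).
split; first exact: le_trans S1 SS'.
  (* Otherwise |b dl^q| exceeds m |s n.+1| and dominates the right side of [muE], so m S > m |s
     n.+1|, against [SS']. *)
  rewrite leNgt; apply/negP => gt_S'; set S' := abs (s n.+1) in SS' gt_S'.
  have S'0 : 0 < S' by apply: lt_le_trans SS'.
  have D : abs (b * dl) = S' by rewrite bdl abs_subl_lt // (lt_le_trans zsS).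
  have PS : S' * m < P.
    rewrite -(ltr_pM2r LX0) PL D exprqS -mulrA ltr_pM2l //.
    by rewrite mulrC.
  have PE : m * S = P.
    by rewrite mS abs_subr_lt // (le_lt_trans _ PS) // ler_peMr // ltW.
  by move: PS; rewrite -PE mulrC ltr_pM2l ?(lt_le_trans ltr01) // ltNge SS'.
by rewrite xS; apply: lt_le_trans SS'; rewrite absM in zsS.
Qed.

End NoNullSolution.

(** * Distance from e to F_q *)

Section NearRational.
Context {R : realType} {Fq : finFieldType} {F : nonarchFieldType R}.
Variable emb : {rmorphism Fq -> F}.
Local Notation q := #|Fq|.
Local Notation frob := (frob emb).

(* At most one factor of prod_c (e - c) is small. *)
Lemma near_rational (e : F) (r : R) : r <= 1 ->
  abs (frob e - e) < r -> exists c, abs (e - emb c) < r.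
Proof.
move=> r1 er; have er1 : abs (frob e - e) < 1 by apply: lt_le_trans r1.
have [c ec1] : exists c, abs (e - emb c) < 1.
  apply: contrapT => /forallNP h.
  move: er1; rewrite frob_sub_prod abs_prod ltNge => /negP; apply.
  elim/big_ind: _ => // [s t s1 t1|c _]; first by rewrite mulr_ege1.
  by rewrite leNgt; apply/negP.
exists c; apply: le_lt_trans er.
rewrite frob_sub_prod abs_prod (bigD1 c) //= big1 ?mulr1 // => c' c'c.
have -> : e - emb c' = (e - emb c) - emb (c' - c) by rewrite rmorphB; ring.
by rewrite abs_subr_lt abs_emb ?subr_eq0.
Qed.

Variables (zeta : F) (M : 'M[F]_2) (u : nat -> 'cV[F]_2).
Hypothesis zeta_lt1 : abs zeta < 1.
Hypothesis trM : M 0 0 + M 1 1 = - (2%:R * zeta).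
Hypothesis detM : M 0 0 * M 1 1 - M 0 1 * M 1 0 = zeta ^+ 2.

(** Trace and determinant give M + zeta the shape required by [forms_ge1]. If e had distance at
    least |b|^-1 from all of F_q, [near_rational] with r = |b|^-1 would give |b (e^q - e)| >= 1, and
    the forms could not tend to 0. *)
Lemma null_solution_near :
  tau_fixed emb M u -> null_seq u -> u 0%N != 0 ->
  1 <= abs (M 0 1) -> abs (M 1 0) <= abs (M 0 1) ->
  exists c, abs (M 0 1) * abs (- (M 0 0 + zeta) / M 0 1 - emb c) < 1.
Proof.
move=> hu u_null u0 b1 cb; set b := M 0 1 in b1 cb *; set e := _ / b.
have b0 : b != 0 by rewrite -abs_gt0 (lt_le_trans ltr01).
have Lp : 0 < abs b by rewrite abs_gt0.
have aE : M 0 0 = - zeta - b * e by rewrite /e mulrCA divff //; ring.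
have dE : M 1 1 = - zeta + b * e.
  by move: trM; rewrite aE => /eqP; rewrite -subr_eq0 => /eqP h;
    apply/eqP; rewrite -subr_eq0 -h; apply/eqP; ring.
have cE : M 1 0 = - (b * e ^+ 2).
  apply: (mulfI b0); have -> : b * M 1 0 = M 0 0 * M 1 1 - zeta ^+ 2.
    by rewrite -detM -/b; ring.
  by rewrite aE dE; ring.
have e1 : abs e <= 1.
  move: cb; rewrite cE absN absM absX ger_pMr // => h.
  by rewrite -(@expr_le1 _ 2) ?abs_ge0.
have [c0E c1E] : (exists c, u 0%N 0 0 = emb c) /\ (exists c, u 0%N 1 0 = emb c).
  by case: hu => hu0 _; split; apply: (@frob_fixed _ _ emb);
    rewrite {2}hu0 mxE.
have [x0 x0E] := c0E; have [z0 z0E] := c1E.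
apply: contrapT => /forallNP far.
have {}far c : 1 <= abs b * abs (e - emb c) by rewrite leNgt; apply/negP/far.
have mu1 : 1 <= abs (b * (frob e - e)).
  rewrite leNgt absM mulrC -ltr_pdivlMr // mul1r; apply/negP => h.
  have [|c] := near_rational _ h; first by rewrite invf_le1.
  by rewrite -[_^-1]mul1r ltr_pdivlMr // mulrC ltNge far.
pose x n := u n 0 0; pose z n := u n 1 0.
(* Since x_0 and z_0 lie in F_q, the form is b z_0 when x_0 = 0, and otherwise - x_0 b (e - z_0 /
   x_0), to which [far] applies. *)
have s0 : 1 <= abs (b * (frob (z 0%N) - e * frob (x 0%N))).
  rewrite /z /x x0E z0E !frob_emb.
  have [x00|x00] := eqVneq x0 0.
    rewrite x00 rmorph0 mulr0 subr0 absM abs_emb ?mulr1 //.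
    apply: contraNneq u0 => z00; apply/eqP/matrixP => i j.
    rewrite ord1 [RHS]mxE; move: i; apply: ord2P.
      by rewrite x0E x00 rmorph0.
    by rewrite z0E z00 rmorph0.
  rewrite (_ : _ - _ = - (emb x0 * (e - emb (z0 / x0)))).
    by rewrite absM absN absM abs_emb // mul1r.
  by rewrite fmorph_div; field; rewrite fmorph_eq0.
have lower := @forms_ge1 _ _ _ emb zeta b e x z zeta_lt1 e1 b1 mu1.
have {}lower n : 1 <= abs (b * (frob (z n) - e * frob (x n))).
  apply: lower => // [k|k||]; rewrite /x /z ?x0E ?z0E ?abs_emb_le1 //.
    by rewrite (tau_fixed_coef _ _ hu) aE.
  by rewrite (tau_fixed_coef _ _ hu) cE dE.
(* The 1 in the minimum ensures that q-th powers of the coefficients are no larger than the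
   coefficients. *)
have r0 : 0 < Num.min (abs b)^-1 1 by rewrite lt_min invr_gt0 Lp ltr01.
have [N /(_ N (leqnn _)) hN] := u_null _ r0.
have small i : abs (frob (u N i 0)) < (abs b)^-1.
  have := hN i; rewrite lt_min => /andP[h1 h2].
  by rewrite abs_frob (le_lt_trans _ h1) // exprq_le1 ?abs_ge0 // ltW.
have := lower N; rewrite leNgt absM => /negP; apply.
rewrite mulrC -ltr_pdivlMr // mul1r; apply: le_lt_trans (abs_subr _ _) _.
rewrite gt_max small /= absM; apply: le_lt_trans (small 0).
by rewrite ler_piMl ?abs_ge0.
Qed.

End NearRational.

(** * Conjugation by GL_2(F_q) *)

Lemma GL_ex (Fq : finFieldType) (A B : 'M[Fq]_2) : A *m B = 1%:M ->
  exists g : {'GL_2[Fq]}, GLval g = A /\ GLval g^-1%g = B.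
Proof.
move=> AB; have [uA _] := mulmx1_unit AB.
exists (@FinRing.Unit ('M[Fq]_2) A uA); split=> //=.
by rewrite -[B](mulKmx uA) AB mulmx1.
Qed.

Section Conjugation.
Context {Fq : finFieldType} {F : fieldType} (emb : {rmorphism Fq -> F}).
Implicit Types (g h : {'GL_2[Fq]}) (M : 'M[F]_2).

Definition conj_mx g M := map_mx emb (GLval g) *m M *m map_mx emb (GLval g^-1%g).

Lemma map_GL_mulV g : map_mx emb (GLval g) *m map_mx emb (GLval g^-1%g) = 1%:M.
Proof.
rewrite -map_mxM -[_ *m _]/(GLval (g * g^-1)%g) mulgV; exact: map_mx1.
Qed.

Lemma map_GL_mulVK g : map_mx emb (GLval g^-1%g) *m map_mx emb (GLval g) = 1%:M.
Proof. by rewrite -{2}[g]invgK map_GL_mulV. Qed.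

Lemma conj_mxM g h M : conj_mx (g * h) M = conj_mx g (conj_mx h M).
Proof.
rewrite /conj_mx invMg -[GLval (g * h)%g]/(GLval g *m GLval h).
by rewrite -[GLval (h^-1 * g^-1)%g]/(GLval h^-1%g *m GLval g^-1%g) !map_mxM
  /= !mulmxA.
Qed.

Lemma conj_mx1 M : conj_mx 1 M = M.
Proof.
rewrite /conj_mx invg1 -[GLval 1%g]/(1%:M : 'M[Fq]_2).
by rewrite map_mx1 mul1mx mulmx1.
Qed.

Lemma tr_conj_mx g M : \tr (conj_mx g M) = \tr M.
Proof. by rewrite /conj_mx mxtrace_mulC mulmxA map_GL_mulVK mul1mx. Qed.

Lemma det_conj_mx g M : \det (conj_mx g M) = \det M.
Proof.
by rewrite /conj_mx !det_mulmx mulrAC -det_mulmx map_GL_mulV det1 mul1r.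
Qed.

Lemma frob_map_GL g n (v : 'M[F]_(2, n)) :
  map_mx (frob emb) (map_mx emb (GLval g) *m v) =
  map_mx emb (GLval g) *m map_mx (frob emb) v.
Proof.
rewrite map_mxM; congr (_ *m _); apply/matrixP => i j.
by rewrite !mxE /= frob_emb.
Qed.

End Conjugation.

Section ConjugateSolutions.
Context {R : realType} {Fq : finFieldType} {F : nonarchFieldType R}.
Variable emb : {rmorphism Fq -> F}.

(** The entries of g are fixed by x -> x^q, so g commutes with sigma. *)
Lemma tau_fixed_conj g (M : 'M[F]_2) u : tau_fixed emb M u ->
  tau_fixed emb (conj_mx emb g M) (fun n => map_mx emb (GLval g) *m u n).
Proof.
case=> u0 uS; split=> [|n]; first by rewrite frob_map_GL -u0.
rewrite !frob_map_GL {1}uS mulmxDr /conj_mx -!mulmxA; congr (_ + _ *m (_ *m _)).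
by rewrite mulmxA map_GL_mulVK mul1mx.
Qed.

Lemma null_seq_conj (g : {'GL_2[Fq]}) (u : nat -> 'cV[F]_2) : null_seq u ->
  null_seq (fun n => map_mx emb (GLval g) *m u n).
Proof.
move=> hu e e0; have [N hN] := hu e e0; exists N => n /hN {}hN i.
rewrite mxE; apply: abs_sum_lt => // k _; rewrite mxE absM.
by apply: le_lt_trans (hN k); rewrite ler_piMl ?abs_ge0 ?abs_emb_le1.
Qed.

Definition good (M : 'M[F]_2) :=
  [/\ abs (M 0 0) < 1, abs (M 1 0) < 1 & abs (M 1 1) < 1].

Lemma null_solution_good (zeta : F) (M : 'M[F]_2) u : abs zeta < 1 ->
  \tr M = - (2%:R * zeta) -> \det M = zeta ^+ 2 ->
  tau_fixed emb M u -> null_seq u -> u 0%N != 0 ->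
  exists g, good (conj_mx emb g M).
Proof.
move=> zeta1; wlog cb : M u / abs (M 1 0) <= abs (M 0 1).
  move=> wl trM detM hu u_null u0.
  have [cb|/ltW bc] := leP (abs (M 1 0)) (abs (M 0 1)); first exact: (wl M u).
  (* The swap of coordinates is its own inverse, and conjugation by it exchanges b and c. *)
  pose A : 'M[Fq]_2 := \matrix_(i, j) (i != j)%:R.
  have [|g [gA gVA]] := @GL_ex _ A A.
    apply/matrixP; apply: ord2P; apply: ord2P;
      by rewrite mul_mx2E !mxE /= ?(mulr0, mul0r, mulr1, addr0, add0r).
  have [||||||h] := wl (conj_mx emb g M) (fun n => map_mx emb (GLval g) *m u n).
  - rewrite /conj_mx gA gVA !mul_mx2E !mxE /= !mulr0n !mulr1n rmorph0 rmorph1.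
    by rewrite !(mulr0, mul0r, mulr1, mul1r, addr0, add0r).
  - by rewrite tr_conj_mx.
  - by rewrite det_conj_mx.
  - exact: tau_fixed_conj.
  - exact: null_seq_conj.
  - apply: contraNneq u0 => h; rewrite -[u _]mul1mx -(map_GL_mulVK emb g).
    by rewrite -mulmxA h mulmx0.
  by rewrite -conj_mxM; exists (h * g)%g.
rewrite mxtrace2E det_mx2E => trM detM hu u_null u0.
have dE : M 1 1 = - zeta - (M 0 0 + zeta).
  by apply: (addrI (M 0 0)); rewrite trM; ring.
have bcE : M 0 1 * M 1 0 = - (M 0 0 + zeta) ^+ 2.
  have -> : M 0 1 * M 1 0 = M 0 0 * M 1 1 - zeta ^+ 2 by rewrite -detM; ring.
  by rewrite dE; ring.
have lt1 s t : abs s < 1 -> abs t < 1 -> abs (s + t) < 1 :> R.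
  by move=> s1 t1; rewrite (le_lt_trans (abs_ultra _ _)) // gt_max s1.
(* If |b| < 1 then (a + zeta)^2 = - b c has absolute value < 1, and g = 1 works. *)
have [b1|b1] := ltP (abs (M 0 1)) 1.
  have al1 : abs (M 0 0 + zeta) < 1.
    rewrite -(@expr_lt1 _ 2) ?abs_ge0 // -absX -absN -bcE absM.
    by rewrite mulr_ilt1 ?abs_ge0 // (le_lt_trans cb).
  exists 1%g; rewrite conj_mx1; split; last by rewrite dE lt1 ?absN.
    by rewrite -(addrK zeta (M 0 0)) lt1 ?absN.
  exact: le_lt_trans cb b1.
have [c hc] := null_solution_near zeta1 trM detM hu u_null u0 b1 cb.
set b := M 0 1 in b1 cb bcE hc; set e := _ / b in hc.
have b0 : b != 0 by rewrite -abs_gt0 (lt_le_trans ltr01).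
have aE : M 0 0 + zeta = - (b * e) by rewrite /e mulrCA divff //; ring.
have cE : M 1 0 = - (b * e ^+ 2).
  by apply: (mulfI b0); rewrite bcE aE; ring.
have be1 : abs (b * (e - emb c)) < 1 by rewrite absM.
have e1 : abs (e - emb c) < 1.
  by apply: le_lt_trans hc; rewrite ler_peMl ?abs_ge0.
(* [A (- c)] maps (1, e)^T to (1, e - c)^T, so conjugation by it replaces e by e - c and keeps b. *)
pose A s : 'M[Fq]_2 := \matrix_(i, j) (if i == j then 1 else (i == 1)%:R * s).
have [|g [gA gVA]] := @GL_ex _ (A (- c)) (A c).
  apply/matrixP; apply: ord2P; apply: ord2P; rewrite mul_mx2E !mxE /=; ring.
exists g; rewrite /good /conj_mx gA gVA !mul_mx2E !mxE /= !mul0r !mul1r.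
rewrite rmorph0 rmorph1 rmorphN -/b dE cE; split.
- rewrite [X in abs X](_ : _ = - zeta - b * (e - emb c)) ?lt1 ?absN //.
  by rewrite -[M 0 0](addrK zeta) aE; ring.
- rewrite [X in abs X](_ : _ = - (b * (e - emb c) * (e - emb c))).
    by rewrite absN absM mulr_ilt1 ?abs_ge0.
  by rewrite -[M 0 0](addrK zeta) aE; ring.
rewrite [X in abs X](_ : _ = - zeta + b * (e - emb c)) ?lt1 ?absN //.
by rewrite aE; ring.
Qed.

End ConjugateSolutions.

(** * At most two independent fixed vectors *)

Section PolynomialAction.
Context {R : realType} {Fq : finFieldType} {F : nonarchFieldType R}.
Variable emb : {rmorphism Fq -> F}.
Implicit Types (p : {poly Fq}) (w : nat -> 'cV[F]_2).

(* The coefficients of the product of p(t) with sum_k (w k) t^k. *)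
Definition poly_act p w k := \sum_(j < k.+1) emb p`_j *: w (k - j)%N.

Lemma poly_actB p p' w k :
  poly_act (p - p') w k = poly_act p w k - poly_act p' w k.
Proof.
rewrite /poly_act -sumrB; apply: eq_bigr => j _.
by rewrite coefB rmorphB scalerBl.
Qed.

Lemma poly_actD p p' w k :
  poly_act (p + p') w k = poly_act p w k + poly_act p' w k.
Proof.
rewrite /poly_act -big_split; apply: eq_bigr => j _ /=.
by rewrite coefD rmorphD scalerDl.
Qed.

Lemma poly_actC c w k : poly_act c%:P w k = emb c *: w k.
Proof.
rewrite /poly_act big_ord_recl coefC /= subn0 big1 ?addr0 // => j _.
by rewrite coefC /= rmorph0 scale0r.
Qed.

Lemma poly_actX0 p w : poly_act (p * 'X) w 0%N = 0.
Proof. by rewrite /poly_act big_ord1 coefMX rmorph0 scale0r. Qed.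

Lemma poly_actXS p w k : poly_act (p * 'X) w k.+1 = poly_act p w k.
Proof.
rewrite /poly_act big_ord_recl coefMX rmorph0 scale0r add0r.
by apply: eq_bigr => j _; rewrite coefMX /= subSS.
Qed.

Variable M : 'M[F]_2.

Lemma tau_fixedD w w' : tau_fixed emb M w -> tau_fixed emb M w' ->
  tau_fixed emb M (fun k => w k + w' k).
Proof.
move=> [w0 wS] [w'0 w'S]; split=> [|k]; first by rewrite map_mxD /= -w0 -w'0.
by rewrite !map_mxD mulmxDr {1}wS {1}w'S addrACA.
Qed.

Lemma tau_fixed0 : tau_fixed emb M (fun=> 0).
Proof. by split=> *; rewrite map_mx0 ?mulmx0 ?addr0. Qed.

Lemma tau_fixed_ext w w' : w =1 w' -> tau_fixed emb M w -> tau_fixed emb M w'.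
Proof. by move=> e [h0 hS]; split=> *; rewrite -!e. Qed.

(** Constants from F_q are fixed by sigma, and multiplication by t only shifts the recursion. *)
Lemma tau_fixed_poly_act p w : tau_fixed emb M w ->
  tau_fixed emb M (poly_act p w).
Proof.
move=> hw; elim/poly_ind: p => [|p c [p0 pS]].
  apply: tau_fixed_ext tau_fixed0 => k.
  by rewrite /poly_act big1 // => j _; rewrite coef0 rmorph0 scale0r.
apply: (@tau_fixed_ext (fun k => poly_act (p * 'X) w k + emb c *: w k)).
  by move=> k; rewrite poly_actD poly_actC.
have frobZ (v : 'cV[F]_2) : map_mx (frob emb) (emb c *: v) =
    emb c *: map_mx (frob emb) v by rewrite map_mxZ /= frob_emb.
apply: tau_fixedD; last first.
  by case: hw => w0 wS; split=> *; rewrite !frobZ -?w0 // {1}wS scalerDr -scalemxAr.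
split=> [|[|k]]; rewrite ?poly_actXS ?poly_actX0 ?map_mx0 ?mulmx0 ?addr0 //.
Qed.

Lemma tau_fixed_sum (I : Type) (r : seq I) (w : I -> nat -> 'cV[F]_2) :
  (forall i, tau_fixed emb M (w i)) ->
  tau_fixed emb M (fun k => \sum_(i <- r) w i k).
Proof.
move=> hw; elim: r => [|i r ih].
  by apply: tau_fixed_ext tau_fixed0 => k; rewrite big_nil.
apply: tau_fixed_ext (tau_fixedD (hw i) ih) => k; by rewrite big_cons.
Qed.

(** After a zero coefficient the next one has entries with x = x^q, and |x| < 1 leaves only x =
    0. *)
Lemma tau_fixed_eq0 s w : tau_fixed emb M w ->
  (forall k, (k < s.+1)%N -> w k = 0) ->
  (forall k, (s < k)%N -> forall i, abs (w k i 0) < 1) -> forall k, w k = 0.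
Proof.
move=> hw low high; elim=> [|k ih]; first exact: low.
have [/low //|/high {}high] := ltnP k.+1 s.+1.
apply/matrixP => i j; rewrite ord1 [RHS]mxE; apply/eqP.
rewrite -abs_eq0 -(abs_AS_lt1 emb) ?high //.
by rewrite (tau_fixed_coef _ _ hw) ih !mxE rmorph0 !mulr0 addr0 abs0.
Qed.

End PolynomialAction.

(** Subtracting a fixed element of a fibre embeds that fibre into B. *)
Lemma card_additive_fibers (V : finZmodType) (T : finType) (f : V -> T)
    (A B : {set V}) :
  {in A &, forall x y, f x = f y -> x - y \in B} -> (#|A| <= #|T| * #|B|)%N.
Proof.
move=> h; rewrite -sum1_card (partition_big f predT) //= -sum_nat_const.
apply: leq_sum => t _; rewrite sum1_card.
have [x hx|h0] := pickP (fun x => (x \in A) && (f x == t)); last first.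
  by rewrite (eq_card0 h0).
rewrite -(card_imset _ (addIr (- x))); apply/subset_leq_card/fintype.subsetP => y.
case/imsetP => z; rewrite unfold_in => /andP[zA /eqP fz] ->.
by case/andP: hx => xA /eqP fx; apply: h; rewrite // fz fx.
Qed.

Section Counting.
Context {R : realType} {Fq : finFieldType} {F : nonarchFieldType R}.
Variable emb : {rmorphism Fq -> F}.
Variables (M : 'M[F]_2) (u : 'I_3 -> nat -> 'cV[F]_2).
Hypothesis u_fixed : forall i, tau_fixed emb M (u i).
Hypothesis u_null : forall i, null_seq (u i).

Let comb n (A : 'M[Fq]_(3, n)) k : 'cV[F]_2 :=
  \sum_i poly_act emb (rVpoly (row i A)) (u i) k.

(* The q^(3n) combinations with coefficients of degree < n have coefficients of
   absolute value < 1 beyond index n + D, where D does not depend on n, so each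
   is determined by its first n + D coefficients; a coefficient preceded by
   zeros lies in F_q^2, which leaves at most q^(2(n + D)) possibilities. *)
Lemma tau_fixed_dependent : exists p : 'I_3 -> {poly Fq},
  (exists i, p i != 0) /\ forall k, \sum_i poly_act emb (p i) (u i) k = 0.
Proof.
have [D hD] : exists D, forall i k, (D <= k)%N -> forall j, abs (u i k j 0) < 1.
  have /choice [D hD] := fun i => u_null i ltr01.
  exists (\max_i D i)%N => i k hk; apply: hD.
  exact: leq_trans (leq_bigmax i) hk.
(* The choice of n gives 3 n = 2 s + 1, so the combinations outnumber the possible initial segments
   by a factor q. *)
pose n := D.*2.+1; pose s := (n + D)%N.
have combB A B k : @comb n (A - B) k = @comb n A k - comb B k.
  rewrite /comb -sumrB; apply: eq_bigr => i _.
  by rewrite !raddfB /= poly_actB.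
have comb_fixed A : tau_fixed emb M (@comb n A).
  by apply: tau_fixed_sum => i; apply: tau_fixed_poly_act.
have comb_small A k j : (s <= k)%N -> abs (@comb n A k j 0) < 1.
  move=> sk; rewrite summxE; apply: abs_sum_lt => // i _.
  rewrite summxE; apply: abs_sum_lt => // l _; rewrite mxE absM.
  have [nl|ln] := leqP n l.
    rewrite nth_default ?rmorph0 ?abs0 ?mul0r //.
    by rewrite (leq_trans (size_poly _ _)).
  apply: le_lt_trans (hD i (k - l)%N _ j); first exact: ler_piMl (abs_ge0 _) (abs_emb_le1 _ _).
  rewrite leq_subRL; first by rewrite (leq_trans _ sk) // /s leq_add2r ltnW.
  by rewrite (leq_trans (ltnW ln)) // (leq_trans _ sk) // leq_addr.
pose V t : {set 'M[Fq]_(3, n)} := finset (fun A => [forall k : 'I_t, comb A k == 0]).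
have VP t A : reflect (forall k, (k < t)%N -> comb A k = 0) (A \in V t).
  rewrite inE; apply: (iffP forallP) => [h k hk|h k]; last by apply/eqP/h.
  by have /eqP := h (Ordinal hk).
have lead t A : A \in V t -> exists v : 'cV[Fq]_2, map_mx emb v = comb A t.
  move=> /VP hA; suff /choice [v hv] : forall i, exists c, emb c = comb A t i 0.
    exists (\col_i v i); apply/matrixP => i j.
    by rewrite ord1 !mxE hv.
  move=> i; suff /frob_fixed [c ->] : frob emb (comb A t i 0) = comb A t i 0.
    by exists c.
  case: (comb_fixed A) hA => c0 cS; case: t => [|t] hA.
    by rewrite {2}c0 mxE.
  by rewrite {2}cS (hA t (ltnSn t)) map_mx0 mulmx0 addr0 mxE.
have step t : (#|V t| <= #|Fq| ^ 2 * #|V t.+1|)%N.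
  have -> : (#|Fq| ^ 2 = #|{: 'cV[Fq]_2}|)%N by rewrite card_mx.
  pose f (A : 'M[Fq]_(3, n)) := odflt 0 [pick v : 'cV[Fq]_2 | map_mx emb v == comb A t].
  have fP A : A \in V t -> map_mx emb (f A) = comb A t.
    move=> /lead [v hv]; rewrite /f; case: pickP => [v' /eqP //|/(_ v)].
    by rewrite hv eqxx.
  apply: (@card_additive_fibers _ _ f) => A B hA hB fE; apply/VP => k.
  rewrite ltnS leq_eqVlt combB => /predU1P[->|kt].
    by rewrite -!fP // fE subrr.
  by rewrite (VP _ _ hA) // (VP _ _ hB) // subrr.
have V0 : #|V 0%N| = (#|Fq| ^ (3 * n))%N.
  rewrite -card_mx; apply: eq_card => A; rewrite !inE.
  by apply/forallP => -[].
have bound t : (#|Fq| ^ (3 * n) <= #|Fq| ^ (2 * t) * #|V t|)%N.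
  elim: t => [|t ih]; first by rewrite V0 muln0 mul1n.
  apply: leq_trans ih _; rewrite mulnS addnC expnD -mulnA leq_mul2l step.
  by rewrite orbT.
have : (1 < #|V s|)%N.
  have := bound s; have -> : (3 * n = 2 * s + 1)%N.
    by rewrite /s /n -!mul2n; lia.
  rewrite expnD leq_pmul2l ?expn_gt0 ?q_gt0 // expn1 => /(leq_trans _); apply.
  exact: q_gt1.
case/card_gt1P => A [B [hA hB AB]].
exists (fun i => rVpoly (row i (A - B))); split.
  apply: contrapT => /forallNP h; case/eqP: AB; apply/eqP.
  rewrite -subr_eq0; apply/eqP/row_matrixP => i; rewrite row0.
  apply: (can_inj (@rVpolyK _ _)); rewrite raddf0; apply/eqP.
  by apply: contrapT => /negP /h.
(* [tau_fixed_eq0] takes the predecessor of the number of vanishing coefficients; s > 0 because n >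
   0. *)
apply: (@tau_fixed_eq0 _ _ _ emb M s.-1) => [|k|k].
- exact: comb_fixed.
- by rewrite prednK // => ks; rewrite -/(comb _ _) combB (VP _ _ hA) // (VP _ _ hB) // subrr.
- by rewrite prednK // => sk i; apply: comb_small.
Qed.

End Counting.

(** * From vectors over F<t> to coefficient sequences *)

Section TateCoefficients.
Context {R : realType} {Fq : finFieldType} {F : nonarchFieldType R}.
Implicit Types (f g : tate1 F) (v w : 'cV[tate1 F]_2).

Definition tcoef f n := mps_coef (tate_val f) (U_(ord0) *+ n)%MM.

Lemma mnm1_deg (m : 'X_{1..1}) : m = (U_(ord0) *+ mdeg m)%MM.
Proof.
apply/mnmP => i; rewrite mdegE big_ord1 mulmnE mnm1E ord1 eqxx mul1n.
by congr (m _); apply: val_inj.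
Qed.

Lemma mdeg_mnm1 n : mdeg (U_(ord0 : 'I_1) *+ n)%MM = n.
Proof. by rewrite mdegMn mdeg1 mul1n. Qed.

Lemma tcoef_inj f g : tcoef f =1 tcoef g -> f = g.
Proof.
move=> h; apply: val_inj; apply: mpsP => m; rewrite (mnm1_deg m); exact: h.
Qed.

Lemma tcoefD f g n : tcoef (f + g) n = tcoef f n + tcoef g n.
Proof. by []. Qed.

Lemma tcoef0 n : tcoef 0 n = 0.
Proof. exact: mps_coef0. Qed.

Lemma tcoef_sum (I : Type) (r : seq I) (f : I -> tate1 F) n :
  tcoef (\sum_(i <- r) f i) n = \sum_(i <- r) tcoef (f i) n.
Proof. exact: (big_morph _ (fun f g => tcoefD f g n) (tcoef0 n)). Qed.

(** Coefficient n of a product sees only degrees up to n, which reduces the products below to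
    polynomial arithmetic. *)
Lemma tcoef_mpolyM p f n : tcoef (tate_of_mpoly p * f) n =
  (p * mps_trunc n.+1 (tate_val f))@_(U_(ord0) *+ n).
Proof.
apply/esym; apply: (agree_mul (d := n.+1)); rewrite ?mdeg_mnm1 //.
exact: agree_trunc.
Qed.

Lemma tcoef_constM c f n : tcoef (tate_const c * f) n = c * tcoef f n.
Proof.
by rewrite tcoef_mpolyM mcoeffCM (agree_trunc (d := n.+1)) ?mdeg_mnm1.
Qed.

Lemma tcoef_tM0 f : tcoef (tate_t F * f) 0 = 0.
Proof.
rewrite tcoef_mpolyM mulm0n mcoeffM big1 // => k /eqP k0.
have /eqP : (mdeg (bmnm k.1) + mdeg (bmnm k.2) = 0)%N.
  by rewrite -mdegD -k0 mdeg0.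
rewrite addn_eq0 => /andP[k1 _].
have kn : (U_(ord0)%MM == bmnm k.1) = false.
  by apply/eqP => h; move: k1; rewrite -h mdeg1.
by rewrite mcoeffX kn mul0r.
Qed.

Lemma tcoef_tMS f n : tcoef (tate_t F * f) n.+1 = tcoef f n.
Proof.
rewrite tcoef_mpolyM mulrC mulmS mcoeffMX (agree_trunc (d := n.+2)) //.
by rewrite mdeg_mnm1 ltnW.
Qed.

Lemma tcoef_null f (e : R) : 0 < e ->
  exists N, forall n, (N <= n)%N -> abs (tcoef f n) < e.
Proof.
move=> /(tate_holds f) [N hN]; exists N => n hn.
by have := hN (U_(ord0) *+ n)%MM; rewrite mdeg_mnm1 expr1n mulr1; apply.
Qed.

Lemma tate_of_seq (x : nat -> F) :
  (forall e : R, 0 < e -> exists N, forall n, (N <= n)%N -> abs (x n) < e) ->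
  exists f : tate1 F, tcoef f =1 x.
Proof.
move=> hx; have h : tate_pred 1 (MPS (fun m : 'X_{1..1} => x (mdeg m))).
  move=> e /hx [N hN]; exists N => m hm /=.
  by rewrite expr1n mulr1 hN.
exists (Tate (introT (asboolP _) h)) => n; by rewrite /tcoef /= mdeg_mnm1.
Qed.

Definition vcoef v n : 'cV[F]_2 := \col_i tcoef (v i 0) n.

Lemma vcoef_inj v w : vcoef v =1 vcoef w -> v = w.
Proof.
move=> h; apply/matrixP => i j; rewrite ord1; apply: tcoef_inj => n.
by have := congr1 (fun A : 'cV_2 => A i 0) (h n); rewrite !mxE.
Qed.

Lemma vcoef0 n : vcoef 0 n = 0.
Proof. by apply/matrixP => i j; rewrite !mxE tcoef0. Qed.

Lemma vcoefD v w n : vcoef (v + w) n = vcoef v n + vcoef w n.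
Proof. by apply/matrixP => i j; rewrite !mxE tcoefD. Qed.

Lemma vcoef_sum (I : Type) (r : seq I) (v : I -> 'cV[tate1 F]_2) n :
  vcoef (\sum_(i <- r) v i) n = \sum_(i <- r) vcoef (v i) n.
Proof. exact: (big_morph _ (fun v w => vcoefD v w n) (vcoef0 n)). Qed.

Lemma vcoef_constZ c v n : vcoef (tate_const c *: v) n = c *: vcoef v n.
Proof. by apply/matrixP => i j; rewrite !mxE tcoef_constM. Qed.

Lemma vcoef_tZ0 v : vcoef (tate_t F *: v) 0 = 0.
Proof. by apply/matrixP => i j; rewrite !mxE tcoef_tM0. Qed.

Lemma vcoef_tZS v n : vcoef (tate_t F *: v) n.+1 = vcoef v n.
Proof. by apply/matrixP => i j; rewrite !mxE tcoef_tMS. Qed.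

Lemma vcoef_constM (M : 'M[F]_2) v n :
  vcoef (map_mx (@tate_const R F 1 1) M *m v) n = M *m vcoef v n.
Proof.
apply/matrixP => i j; rewrite !mxE tcoef_sum; apply: eq_bigr => k _.
by rewrite !mxE tcoef_constM.
Qed.

Lemma vcoef_null v : null_seq (vcoef v).
Proof.
move=> e e0; have /choice [N hN] := fun i => tcoef_null (v i 0) e0.
exists (\max_i N i)%N => n hn i; rewrite mxE hN //.
exact: leq_trans (leq_bigmax i) hn.
Qed.

Lemma vec_of_seq (u : nat -> 'cV[F]_2) : null_seq u ->
  exists v, vcoef v =1 u.
Proof.
move=> hu; have /choice [f hf] : forall i, exists f : tate1 F,
    tcoef f =1 (fun n => u n i 0).
  move=> i; apply: tate_of_seq => e /hu [N hN].
  by exists N => n hn; apply: hN.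
exists (\col_i f i) => n; apply/matrixP => i j; by rewrite ord1 !mxE hf.
Qed.

Variable emb : {rmorphism Fq -> F}.

Lemma vcoef_sigma v n :
  vcoef (map_mx (@tate_sigma R Fq F) v) n = map_mx (frob emb) (vcoef v n).
Proof. by apply/matrixP => i j; rewrite !mxE. Qed.

Lemma vcoef_scale p v n :
  vcoef (Fqt_scale emb p v) n = poly_act emb p (vcoef v) n.
Proof.
pose h : {rmorphism Fq -> tate1 F} :=
  (@tate_of_mpoly R F 1 1) \o ((@mpolyC 1 F) \o emb).
rewrite /Fqt_scale -[map_poly _ p]/(map_poly h p).
elim/poly_ind: p n => [|p c ih] n.
  rewrite rmorph0 horner0 scale0r vcoef0 /poly_act big1 // => j _.
  by rewrite coef0 rmorph0 scale0r.
rewrite rmorphD rmorphM /= map_polyX map_polyC /= hornerD hornerMX hornerC.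
rewrite scalerDl vcoefD [in RHS]poly_actD poly_actC [_ * tate_t F]mulrC -scalerA.
rewrite vcoef_constZ; congr (_ + _).
by case: n => [|n]; rewrite ?vcoef_tZ0 ?poly_actX0 // vcoef_tZS poly_actXS ih.
Qed.

Lemma tau_fixedP (M : 'M[F]_2) v :
  tau Fq (1%:M + tate_t F *: map_mx (@tate_const R F 1 1) M) v = v <->
  tau_fixed emb M (vcoef v).
Proof.
rewrite /tau mulmxDl mul1mx -scalemxAl; set w := _ + _.
have w0 : vcoef w 0 = map_mx (frob emb) (vcoef v 0).
  by rewrite vcoefD vcoef_tZ0 addr0 vcoef_sigma.
have wS n : vcoef w n.+1 =
    map_mx (frob emb) (vcoef v n.+1) + M *m map_mx (frob emb) (vcoef v n).
  by rewrite vcoefD vcoef_tZS vcoef_constM !vcoef_sigma.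
split=> [wv|[v0 vS]]; first by split=> *; rewrite -?w0 -?wS wv.
by apply: vcoef_inj => -[|n]; rewrite ?w0 ?wS -?v0 -?vS.
Qed.

End TateCoefficients.

(** * The rank of the module of fixed vectors *)

Section RankTwo.
Context {R : realType} {Fq : finFieldType} {k : nonarchFieldType R}.
Context {F : completed_alg_closure k} (emb : {rmorphism Fq -> F}).
Variables (zeta : F) (M : 'M[F]_2).
Hypotheses (zeta_lt1 : abs zeta < 1) (trM : \tr M = - (2%:R * zeta)).
Hypothesis detM : \det M = zeta ^+ 2.

Let Delta : 'M[tate1 F]_2 :=
  1%:M + tate_t F *: map_mx (@tate_const R F 1 1) M.

(** [null_solution_good] needs a nonzero first term, so v is divided by the largest power of t; the
    sequence still solves the recursion because the coefficient before the new start is 0. *)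
Lemma fixed_vector_good (v : 'cV[tate1 F]_2) : tau Fq Delta v = v -> v != 0 ->
  exists g, good (conj_mx emb g M).
Proof.
move=> /(tau_fixedP emb) [v0 vS] vn0.
have ex : exists n, vcoef v n != 0.
  apply: contrapT => /forallNP h; case/eqP: vn0; apply: vcoef_inj => n.
  by rewrite vcoef0; apply/eqP; apply: contrapT => /negP /h.
case: (ex_minnP ex) => n n0 nmin.
apply: (@null_solution_good _ _ _ emb zeta M (fun j => vcoef v (n + j)%N)) => //.
- split=> [|j]; last by rewrite addnS.
  rewrite addn0; case: n {n0} nmin => [|n] nmin; first exact: v0.
  rewrite {1}vS; have -> : vcoef v n = 0.
    by apply/eqP; apply: contraT => /nmin; rewrite ltnn.
  by rewrite map_mx0 mulmx0 addr0.
- move=> e /(vcoef_null v) [N hN]; exists N => j hj.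
  by apply: hN; rewrite (leq_trans hj) // leq_addl.
- by rewrite addn0.
Qed.

(** The equation is solved for the conjugated matrix from the initial value g x, and the solution is
    moved back by g^-1. *)
Lemma good_fixed_vector g (x : 'cV[Fq]_2) : good (conj_mx emb g M) ->
  exists v, tau Fq Delta v = v /\ vcoef v 0 = map_mx emb x.
Proof.
move=> gd; have [a1 c1 d1] := gd.
have bc1 : abs (conj_mx emb g M 0 1 * conj_mx emb g M 1 0) < 1.
  have := det_conj_mx emb g M; rewrite detM det_mx2E => /eqP.
  rewrite subr_eq addrC -subr_eq => /eqP <-.
  rewrite (le_lt_trans (abs_subr _ _)) // gt_max absM absX.
  by rewrite mulr_ilt1 ?abs_ge0 // exprn_ilt1 ?abs_ge0.
have [u [hu u_null u0]] := exists_null_solution (GLval g *m x)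
  (AS_root_completion emb) a1 c1 d1 bc1.
have := tau_fixed_conj g^-1%g hu; rewrite -conj_mxM mulVg conj_mx1 => hu'.
have [v hv] := vec_of_seq (null_seq_conj emb g^-1%g u_null).
exists v; split.
  by apply/(tau_fixedP emb); apply: tau_fixed_ext hu' => n; rewrite hv.
by rewrite hv u0 map_mxM mulmxA map_GL_mulVK mul1mx.
Qed.

Lemma rank2_iff : has_rank (Fqt_scale emb) [set f | tau Fq Delta f = f] 2 <->
  exists g, good (conj_mx emb g M).
Proof.
split=> [[[u [hu indep]] _]|[g gd]].
  apply: (@fixed_vector_good (u 0)) (hu 0) _; apply/eqP => u0.
  (* If u 0 = 0, the coefficients (1, 0) violate independence. *)
  suff h : \sum_i Fqt_scale emb (i == 0)%:R (u i) = 0.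
    by have /eqP := indep _ h 0; rewrite eqxx oner_eq0.
  apply: vcoef_inj => n; rewrite vcoef_sum vcoef0 big1 // => i _.
  rewrite vcoef_scale; case: eqP => [->|_].
    by rewrite u0 /poly_act big1 // => j _; rewrite vcoef0 scaler0.
  by rewrite /poly_act big1 // => j _; rewrite coef0 rmorph0 scale0r.
split.
  have /choice [u hu] := fun i : 'I_2 => good_fixed_vector (delta_mx i 0) gd.
  exists u; split=> [i|x hx i]; first by have [] := hu i.
  have {}hx n : \sum_i poly_act emb (x i) (vcoef (u i)) n = 0.
    have := congr1 (fun v => vcoef v n) hx; rewrite vcoef0 vcoef_sum => hxn.
    rewrite -[RHS]hxn.
    by apply: eq_bigr => j _; rewrite vcoef_scale.
  suff xn n j : (x j)`_n = 0 by apply/polyP => n; rewrite xn coef0.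
  (* The u i start with the standard basis vectors. Once all lower coefficients of the x i vanish,
     coefficient n of the relation is the vector of the n-th coefficients of the x i. *)
  elim/ltn_ind: n j => n ih j; have := hx n.
  rewrite (eq_bigr (fun i => emb (x i)`_n *: map_mx emb (delta_mx i 0))).
    move=> /(congr1 (fun A : 'cV_2 => A j 0)); rewrite summxE (bigD1 j) //= big1.
      rewrite !mxE !eqxx rmorph1 mulr1 addr0 => /eqP.
      by rewrite fmorph_eq0 => /eqP.
    by move=> l lj; rewrite !mxE eq_sym (negPf lj) rmorph0 mulr0.
  move=> l _; have [_ <-] := hu l; rewrite /poly_act big_ord_recr /= subnn.
  by rewrite big1 ?add0r // => m _; rewrite ih // rmorph0 scale0r.
case=> u [hu indep].
have fixed i : tau_fixed emb M (vcoef (u i)) by apply/tau_fixedP/hu.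
have [p [[i pi0] hp]] := tau_fixed_dependent fixed (fun i => vcoef_null (u i)).
case/eqP: pi0; apply: indep; apply: vcoef_inj => n.
rewrite vcoef0 vcoef_sum -[RHS](hp n); apply: eq_bigr => j _.
exact: vcoef_scale.
Qed.

End RankTwo.

(** * The action on analytic points *)

Lemma mps_linsubstK (n : nat) (A : comNzRingType)
    (lq lq' : n.-tuple {mpoly A[n]}) (f : mps n A) :
  (forall i, tnth lq i \is 1.-homog) -> (forall i, tnth lq' i \is 1.-homog) ->
  (forall i, tnth lq i \mPo lq' = 'X_i) ->
  mps_linsubst lq' (mps_linsubst lq f) = f.
Proof.
(* Linear substitutions respect degrees, so the identity can be checked on truncations, monomial by
   monomial. *)
move=> hlq hlq' lqK; apply: mps_eq => d; exists (mps_trunc d f).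
split; last exact: agree_trunc.
have {1}<- : mps_trunc d f \mPo lq \mPo lq' = mps_trunc d f.
  rewrite (comp_mpolyEX (mps_trunc d f)) raddf_sum /= [RHS]mpolyE; apply: eq_bigr => m _.
  rewrite comp_mpolyZ comp_mpolyX rmorph_prod /= mpolyXE_id; congr (_ *: _).
  by apply: eq_bigr => i _; rewrite rmorphXn /= lqK.
by do 2!apply: agree_linsubst => //; apply: agree_trunc.
Qed.

Section ConjugationAction.
Context {R : realType} {Fq : finFieldType} {L : infinity_completion R Fq}.
Context {zeta : L}.
Implicit Types (g : {'GL_2[Fq]}) (P Q : local_point zeta) (y : Xan zeta).

Lemma comp_conj_generic_mx g h : map_mx (comp_mpoly (conj_forms L h))
    (conj_generic_mx L g) = GL_mx L g *m conj_generic_mx L h *m GL_mx L g^-1%g.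
Proof.
have GL_comp g' : map_mx (comp_mpoly (conj_forms L h)) (GL_mx L g') = GL_mx L g'.
  by apply/matrixP => i j; rewrite !mxE comp_mpolyC.
have gen_comp : map_mx (comp_mpoly (conj_forms L h)) (generic_mx L) =
    conj_generic_mx L h.
  by apply/matrixP => i j; rewrite mxE comp_generic_mx.
rewrite [X in map_mx _ X]/conj_generic_mx.
rewrite (map_mxM (comp_mpoly (conj_forms L h))).
rewrite (map_mxM (comp_mpoly (conj_forms L h))).
by rewrite !GL_comp gen_comp.
Qed.

Lemma conj_pullbackK g N (f : ball_algebra L N) :
  conj_pullback g^-1%g (conj_pullback g f) = f.
Proof.
apply/val_inj/mps_linsubstK => [i|i|k]; try exact: conj_forms_homog.
case/mxvec_indexP: k => i j; rewrite conj_formsE.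
have := comp_conj_generic_mx g g^-1%g; rewrite {2}/conj_generic_mx invgK.
rewrite !mulmxA.
have gg : GL_mx L g *m GL_mx L g^-1%g = 1%:M.
  by rewrite -{1}[g]invgK GL_mxV.
rewrite gg mul1mx -mulmxA gg mulmx1 => /matrixP /(_ i j).
by rewrite [LHS]mxE => ->; rewrite mxE.
Qed.

Lemma glued_conj g P Q : glued P Q ->
  glued (Tagged (analytic_point zeta) (conj_point g (tagged P)))
        (Tagged (analytic_point zeta) (conj_point g (tagged Q))).
Proof.
case=> M [lP [lQ h]]; exists M, lP, lQ => f /=.
have restr N (le_NM : (N <= M)%N) :
    conj_pullback g (tate_restr (le_abs_thetaX L le_NM) f) =
    tate_restr (le_abs_thetaX L le_NM) (conj_pullback g f).
  exact: val_inj.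
by rewrite !restr h.
Qed.

Lemma glued_conjK g P : glued
  (Tagged (analytic_point zeta) (conj_point g^-1%g (conj_point g (tagged P)))) P.
Proof.
exists (tag P), (leqnn _), (leqnn _) => f /=; congr (snorm _ _).
have -> : tate_restr (le_abs_thetaX L (leqnn (tag P))) f = f by apply: val_inj.
have fK := conj_pullbackK g^-1%g f; rewrite invgK in fK.
exact: fK.
Qed.

Lemma pi_glued P Q : \pi_(Xan zeta)%qT P = \pi_(Xan zeta)%qT Q <-> glued P Q.
Proof.
split=> [/eqmodP /asboolP //|h].
by apply/eqmodP/asboolP.
Qed.

Lemma conj_actK g y : conj_act g^-1%g (conj_act g y) = y.
Proof.
rewrite /conj_act -[RHS]reprK; apply/pi_glued.
apply: (glued_trans _ (glued_conjK g (repr y))).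
apply: (glued_conj _ (Q := Tagged (analytic_point zeta) (conj_point g (tagged (repr y))))).
by apply/pi_glued; rewrite reprK.
Qed.

(** The chosen representative of [conj_act g y] is only glued to the conjugated point, but a
    polynomial is defined on every ball, and its value is unchanged by restriction. *)
Lemma snorm_conj_act g y p :
  snorm (tagged (repr (conj_act g y))) (tate_of_mpoly p) =
  snorm (tagged (repr y)) (tate_of_mpoly (p \mPo conj_forms L g)).
Proof.
have /pi_glued [M [lP [lQ h]]] : \pi_(Xan zeta)%qT (repr (conj_act g y)) =
    \pi_(Xan zeta)%qT (Tagged (analytic_point zeta) (conj_point g (tagged (repr y)))).
  by rewrite reprK.
have := h (tate_of_mpoly p).
have restr N (le_NM : (N <= M)%N) :
    tate_restr (le_abs_thetaX L le_NM) (tate_of_mpoly p) = tate_of_mpoly p.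
  exact: val_inj.
by rewrite !restr => ->; rewrite /= /conj_pullback tate_linsubst_mpoly.
Qed.

End ConjugationAction.

(** * Values of the coordinates in the residue field, and the theorem *)

Section ResidueField.
Context {R : realType} {Fq : finFieldType} {L : infinity_completion R Fq}.
Context {zeta : L} {y : Xan zeta} (k : residue_field y).

Let ev : {rmorphism {mpoly L[2 * 2]} -> k} :=
  resf_eval k \o @tate_of_mpoly R L (2 * 2) (theta L ^+ tag (repr y)).

Definition Fq_in_residue : {rmorphism Fq -> k} :=
  (ev \o @mpolyC (2 * 2) L) \o Kinf_const L.

Lemma ev_conj_generic g : map_mx ev (conj_generic_mx L g) =
  conj_mx Fq_in_residue g (Delta1_at k).
Proof.
rewrite /conj_mx /conj_generic_mx !map_mxM.
by congr (_ *m _ *m _); apply/matrixP => i j; rewrite !mxE.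
Qed.

Lemma ev_rel_eq0 p :
  X_ideal zeta (tate_of_mpoly p : ball_algebra L (tag (repr y))) -> ev p = 0.
Proof.
by move=> hp; apply/eqP; rewrite -abs_eq0 /= resf_abs snorm_ideal.
Qed.

Lemma Delta1_atE i j : Delta1_at k i j = ev (generic_mx L i j).
Proof. by rewrite mxE. Qed.

Lemma tr_Delta1 : \tr (Delta1_at k) = - (2%:R * ev zeta%:MP).
Proof.
have : ev (trace_rel zeta) = 0.
  by apply: ev_rel_eq0; exists 1, 0; rewrite mul1r mul0r addr0.
rewrite /trace_rel mpolyCM (rmorph_nat (@mpolyC (2 * 2) L)) 2!(rmorphD ev).
rewrite (rmorphM ev) (rmorph_nat ev) -!Delta1_atE => h.
by apply/eqP; rewrite -addr_eq0 mxtrace2E h.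
Qed.

Lemma det_Delta1 : \det (Delta1_at k) = ev zeta%:MP ^+ 2.
Proof.
have : ev (det_rel zeta) = 0.
  by apply: ev_rel_eq0; exists 0, 1; rewrite mul1r mul0r add0r.
rewrite /det_rel (rmorphXn (@mpolyC (2 * 2) L)) 2!(rmorphB ev) 2!(rmorphM ev).
rewrite (rmorphXn ev) -!Delta1_atE => h.
by apply/eqP; rewrite -subr_eq0 det_mx2E h.
Qed.

Lemma abs_ev_zeta : abs (ev zeta%:MP) = abs zeta.
Proof. by rewrite /= resf_abs -(snorm_const (tagged (repr y))). Qed.

Context (F : completed_alg_closure k).

(** The embedding of k(y) into F is isometric, so the criterion of [rank2_iff] over F can be read
    off in k(y). *)
Lemma analytically_trivial_good : abs zeta < 1 ->
  analytically_trivial F <->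
  exists g, good (conj_mx Fq_in_residue g (Delta1_at k)).
Proof.
move=> zeta1; pose iota : {rmorphism k -> F} := calgc_in F \o algc_in F.
have abs_iota x : abs (iota x) = abs x by rewrite /= calgc_abs algc_abs.
pose emb : {rmorphism Fq -> F} := iota \o Fq_in_residue.
have := @rank2_iff R Fq k F emb (iota (ev zeta%:MP)) (map_mx iota (Delta1_at k)).
rewrite abs_iota abs_ev_zeta trace_map_mx det_map_mx tr_Delta1 det_Delta1.
rewrite rmorphN rmorphM rmorph_nat rmorphXn => /(_ zeta1 erefl erefl).
rewrite -map_mx_comp => h; apply: iff_trans h _.
have conjE g : conj_mx emb g (map_mx iota (Delta1_at k)) =
    map_mx iota (conj_mx Fq_in_residue g (Delta1_at k)).
  by rewrite /conj_mx !map_mxM /= -!map_mx_comp.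
by split=> -[g gd]; exists g; move: gd; rewrite conjE /good !mxE !abs_iota.
Qed.

End ResidueField.

Theorem proposition7p1 (R : realType) (Fq : finFieldType)
    (L : infinity_completion R Fq) (zeta : L) (zeta_lt1 : abs zeta < 1)
    (k : forall y : Xan zeta, residue_field y)
    (F : forall y : Xan zeta, completed_alg_closure (k y)) :
  [set y | analytically_trivial (F y)] =
  \bigcup_(g in [set: {'GL_2[Fq]}])
    conj_act g @` [set y | [/\ abs (Delta1_at (k y) 0 0) < 1,
                               abs (Delta1_at (k y) 1 0) < 1
                             & abs (Delta1_at (k y) 1 1) < 1]].
Proof.
(* The two matrices live over different residue fields; only the absolute values of their entries,
   which are seminorms of polynomials, can be compared. *)
have absE g y i j : abs (Delta1_at (k (conj_act g y)) i j) =
    abs (conj_mx (Fq_in_residue (k y)) g (Delta1_at (k y)) i j).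
  rewrite Delta1_atE -ev_conj_generic [map_mx _ _ i j]mxE /= !resf_abs.
  by rewrite snorm_conj_act comp_generic_mx.
apply/seteqP; split=> y /=.
  move=> /(analytically_trivial_good _ zeta_lt1) [g gd].
  (* Since g moves y into the region, y is the image under g^-1 of a point of the region. *)
  exists g^-1%g => //; exists (conj_act g y); last exact: conj_actK.
  by rewrite /= !absE.
case=> g _ [y' gd <-]; apply/(analytically_trivial_good _ zeta_lt1).
by exists g^-1%g; rewrite /good -!absE conj_actK.
Qed.
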